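(* Let $X$ be a complex infinite-dimensional separable Banach space and let $T$ be a continuous linear operator on $X$. Then $T$ is reiteratively hypercyclic if and only if there exists some $x\in X$ such that for every non-empty open set $U\subseteq X$ and every $r\in\mathbb{N}$, $$\Big\{k\in\mathbb{N}: \overline{Bd}\Big(\Big\{a\in\mathbb{N}: T^ax\in T^{-k}U\cap\cdots\cap T^{-rk}U\cap U\Big\}\Big)>0\Big\}\in\mathcal{D}^*.$$
   Context: $\mathbb{N}=\{1,2,3,\dots\}$. For $A\subseteq\mathbb{N}$, the upper Banach density is $\overline{Bd}(A)=\lim_{s\to\infty}\alpha^s/s$ with $\alpha^s=\limsup_{k\to\infty}|A\cap[k+1,k+s]|$. $T$ is reiteratively hypercyclic if there exists $x\in X$ such that for every non-empty open set $U\subseteq X$ the set $\{n\ge 0: T^nx\in U\}$ has positive upper Banach density. $\beta\mathbb{N}$ is the set of ultrafilters on $\mathbb{N}$, with the operation: $A\in p+q$ if and only if $\{n\in\mathbb{N}: -n+A\in q\}\in p$, where $-n+A=\{m\in\mathbb{N}: n+m\in A\}$. An essential idempotent is a $p\in\beta\mathbb{N}$ with $p+p=p$ such that every member of $p$ has positive upper Banach density. $\mathcal{D}^*$ is the intersection of all essential idempotents, i.e. $A\in\mathcal{D}^*$ if and only if $A\in p$ for every essential idempotent $p$. *)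

(* Defs.v *)
From HB Require Import structures.
From mathcomp Require Export all_boot all_order all_algebra.
From mathcomp Require Export finmap.
From mathcomp Require Export all_classical all_reals all_analysis.
From mathcomp Require Export complex.
Set Implicit Arguments.
Unset Strict Implicit.
Unset Printing Implicit Defensive.
Import Order.TTheory GRing.Theory Num.Theory.
Import numFieldNormedType.Exports.
Local Open Scope classical_set_scope.
Local Open Scope ring_scope.

(* [max_window R A s] is alpha^s = limsup_k |A `&` [k+1, k+s]|.  The windows
   never contain 0, so A and A `\ 0 have the same density.  The sequence in k
   is bounded by s, so the real-valued [limn_sup] is the actual limsup, and
   alpha^s / s converges because alpha^s is subadditive in s; neither limit
   operator takes its default value.  At s = 0 the quotient is 0. *)
Definition max_window (R : realType) (A : set nat) (s : nat) : R :=
  limn_sup (fun k : nat => #|` fset_set (A `&` `[k.+1, (k + s)%N]) |%:R).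

Definition upper_banach_density (R : realType) (A : set nat) : R :=
  limn (fun s : nat => max_window R A s / s%:R).

Definition posnat : Type := {n : nat | (0 < n)%N}.

Lemma posnat_add_gt0 (m n : posnat) : (0 < val m + val n)%N.
Proof. by rewrite addn_gt0 (valP m). Qed.

Definition posnat_add (m n : posnat) : posnat :=
  exist _ (val m + val n)%N (posnat_add_gt0 m n).

(* The order of the factors matters: [ultra_add] is not commutative, and here
   the outer quantifier is that of p. *)
Definition ultra_add (p q : set_system posnat) : set_system posnat :=
  [set A | p [set n | q [set m | A (posnat_add n m)]]].

Definition essential_idempotent (R : realType) (p : set_system posnat) : Prop :=
  [/\ UltraFilter p, ultra_add p p = p &
      forall A, p A -> 0 < upper_banach_density R (val @` A)].

Definition Dstar (R : realType) : set_system posnat :=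
  [set A | forall p, essential_idempotent R p -> p A].

Definition separable_space (X : topologicalType) : Prop :=
  exists D : set X, countable D /\ dense D.

Definition infinite_dimensional (K : fieldType) (V : lmodType K) : Prop :=
  ~ exists (n : nat) (e : 'I_n -> V),
      forall v : V, exists c : 'I_n -> K, v = \sum_(i < n) c i *: e i.

Definition reiteratively_hypercyclic (R : realType) (X : normedModType R[i])
    (T : X -> X) : Prop :=
  exists x : X, forall U : set X, open U -> U !=set0 ->
    0 < upper_banach_density R [set n | U (iter n T x)].

(* Main.v *)
(* By Szemeredi-type recurrence, if the orbit of [x] meets the open set [U]
   along a set [A] of positive upper Banach density, then every finite-sums set
   generated by enough positive integers contains a [k] such that [A] contains
   some [a, a + k, .., a + r k]. Then [T^a x] lies in the open set
   [V = U `&` T^-k U `&` .. `&` T^-rk U], so the orbit visits [V] with positive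
   density too. Members of an idempotent ultrafilter contain arbitrarily long
   finite-sums sets, whence the recurrence set of [k]s belongs to all of them.
   Conversely the condition has content because an essential idempotent exists
   (Ellis' lemma for the filter of sets with density-null complement).

   The recurrence result comes from the density Hales-Jewett theorem applied to
   the words [w] with [a + \sum_i w_i x_i] in [A]. The latter is proved by
   induction on the alphabet, from [K] to [option K], along the lines of Dodos,
   Kanellopoulos and Tyros. A word over [option K] containing [None] is at the
   same time a combinatorial line over [K]. If a line-free set [A] has almost the
   critical density, all its fibers have nearly the same density; the theorem for
   [K] and the Graham-Rothschild theorem give a subspace in which every line over
   [K] lies in a positive proportion of the fibers. The points [None] of those
   lines avoid [A]: hence [A] is denser on the complement of this set of points,
   which is a disjoint union of intersections of insensitive sets. These are
   almost partitioned into subspaces, so [A] is too dense on some subspace. *)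

Require Import Defs.
From HB Require Import structures.
From mathcomp Require Import all_boot all_order all_algebra.
From mathcomp Require Import finmap.
From mathcomp Require Import all_classical all_reals all_analysis.
From mathcomp Require Import complex.
From mathcomp Require Import ring lra zify.
Set Implicit Arguments.
Unset Strict Implicit.
Unset Printing Implicit Defensive.
Import Order.TTheory GRing.Theory Num.Theory.
Import numFieldNormedType.Exports.
Local Open Scope classical_set_scope.
Local Open Scope ring_scope.

(** * Averages over words *)

(** Recursion on the first letter makes fibers over an initial segment appear by computation. Over
    an empty alphabet the value is 0 as soon as [n > 0], whence the hypotheses [0 < #|K|] below. *)
Fixpoint avg (R : realType) (K : finType) (n : nat) (f : seq K -> R) : R :=
  if n is n'.+1 then #|K|%:R^-1 * \sum_a avg n' (fun w => f (a :: w)) else f [::].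

Lemma eq_avg (R : realType) (K : finType) n (f g : seq K -> R) :
  (forall w, size w = n -> f w = g w) -> avg n f = avg n g.
Proof.
elim: n f g => [|n IH] f g fg /=; first exact: fg.
by congr (_ * _); apply: eq_bigr => a _; apply: IH => w sw; rewrite fg //= sw.
Qed.

Lemma le_avg (R : realType) (K : finType) n (f g : seq K -> R) :
  (forall w, size w = n -> f w <= g w) -> avg n f <= avg n g.
Proof.
elim: n f g => [|n IH] f g fg /=; first exact: fg.
rewrite ler_wpM2l ?invr_ge0 ?ler0n //; apply: ler_sum => a _; apply: IH => w sw.
by rewrite fg //= sw.
Qed.

Lemma avgD (R : realType) (K : finType) n (f g : seq K -> R) :
  avg n (fun w => f w + g w) = avg n f + avg n g.
Proof.
elim: n f g => [|n IH] f g //=.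
by rewrite -mulrDr -big_split; congr (_ * _); apply: eq_bigr => a _; rewrite IH.
Qed.

Lemma avgZ (R : realType) (K : finType) n c (f : seq K -> R) :
  avg n (fun w => c * f w) = c * avg n f.
Proof.
elim: n f => [|n IH] f //=.
by rewrite mulrCA; congr (_ * _); rewrite mulr_sumr; apply: eq_bigr => a _; rewrite IH.
Qed.

Lemma avgB (R : realType) (K : finType) n (f g : seq K -> R) :
  avg n (fun w => f w - g w) = avg n f - avg n g.
Proof.
rewrite avgD; congr (_ + _); rewrite -mulN1r -avgZ.
by apply: eq_avg => w _; rewrite mulN1r.
Qed.

Lemma avg_cst (R : realType) (K : finType) n (c : R) :
  (0 < #|K|)%N -> avg n (fun _ : seq K => c) = c.
Proof.
move=> K0; elim: n => //= n ->.
by rewrite sumr_const -[c *+ _]mulr_natl mulrA mulVf ?mul1r // pnatr_eq0 -lt0n.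
Qed.

Lemma avg0 (R : realType) (K : finType) n : avg n (fun _ : seq K => 0) = 0 :> R.
Proof. by elim: n => //= n ->; rewrite sumr_const mul0rn mulr0. Qed.

Lemma avg_ge0 (R : realType) (K : finType) n (f : seq K -> R) :
  (forall w, size w = n -> 0 <= f w) -> 0 <= avg n f.
Proof. by move=> f0; rewrite -(avg0 R K n); apply: le_avg. Qed.

Lemma avg_le_cst (R : realType) (K : finType) n (c : R) (f : seq K -> R) :
  (0 < #|K|)%N -> (forall w, size w = n -> f w <= c) -> avg n f <= c.
Proof. by move=> K0 fc; rewrite -[leRHS](avg_cst n c K0); apply: le_avg. Qed.

Lemma avg_ge_cst (R : realType) (K : finType) n (c : R) (f : seq K -> R) :
  (0 < #|K|)%N -> (forall w, size w = n -> c <= f w) -> c <= avg n f.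
Proof. by move=> K0 fc; rewrite -[leLHS](avg_cst n c K0); apply: le_avg. Qed.

Lemma avg_sum (R : realType) (K : finType) (I : Type) (r : seq I) (P : pred I) n
    (f : I -> seq K -> R) :
  avg n (fun w => \sum_(i <- r | P i) f i w) = \sum_(i <- r | P i) avg n (f i).
Proof.
elim: r => [|i r IH].
  by rewrite big_nil -[RHS](avg0 R K n); apply: eq_avg => w _; rewrite big_nil.
rewrite big_cons; case: ifP => Pi.
  by rewrite -IH -avgD; apply: eq_avg => w _; rewrite big_cons Pi.
by rewrite -IH; apply: eq_avg => w _; rewrite big_cons Pi.
Qed.

Lemma avg_cat (R : realType) (K : finType) m n (f : seq K -> R) :
  avg (m + n) f = avg m (fun u => avg n (fun v => f (u ++ v))).
Proof.
elim: m f => [|m IH] f //=.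
by congr (_ * _); apply: eq_bigr => a _; rewrite IH.
Qed.

Lemma exchange_avg (R : realType) (K L : finType) m n (f : seq K -> seq L -> R) :
  avg m (fun u => avg n (f u)) = avg n (fun v => avg m (f ^~ v)).
Proof.
elim: m f => [|m IH] f //=.
rewrite avgZ avg_sum; congr (_ * _); apply: eq_bigr => a _; exact: IH.
Qed.

Lemma avg_ex (R : realType) (K : finType) n (c : R) (f : seq K -> R) :
  (0 < #|K|)%N -> c <= avg n f -> exists2 w, size w = n & c <= f w.
Proof.
move=> K0 cf; apply: contrapT => nex.
have lt_fc w : size w = n -> f w < c.
  by move=> sw; rewrite ltNge; apply/negP => ?; apply: nex; exists w.
elim: n f cf lt_fc {nex} => [|n IH] f /= cf lt_fc.
  by have := lt_fc [::] erefl; rewrite ltNge cf.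
have [[a ca]|nca] := pselect (exists a, c <= avg n (fun w => f (a :: w))).
  by apply: (IH _ ca) => w sw; apply: lt_fc; rewrite /= sw.
have : avg n.+1 f < c.
  rewrite /= mulrC ltr_pdivrMr ?ltr0n // mulr_natr -sumr_const.
  have [a _] := card_gt0P K0.
  apply: Num.Theory.ltr_sum => [|b _]; first by apply/hasP; exists a; rewrite ?mem_index_enum.
  by rewrite ltNge; apply/negP => ?; apply: nca; exists b.
by rewrite ltNge cf.
Qed.

(** The single word [t] has mass [#|K|%:R ^- n], so its deficit costs the average that much. When
    the average is close to [b], this bounds every value of [g] from below. *)
Lemma avg_point (R : realType) (K : finType) n (b : R) (g : seq K -> R) t :
  (0 < #|K|)%N -> (forall w, size w = n -> g w <= b) -> size t = n ->
  avg n g <= b - #|K|%:R ^- n * (b - g t).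
Proof.
move=> K0; elim: n g t => [|n IH] g [|a t] //= gb.
  by move=> _; rewrite expr0 invr1 mul1r; lra.
case=> st.
have k0 : 0 < #|K|%:R :> R by rewrite ltr0n.
rewrite mulrC ler_pdivrMr // (bigD1 a) //=.
have h1 := IH (fun w => g (a :: w)) t (fun w sw => gb (a :: w) (congr1 S sw)) st.
have h2 : \sum_(i | i != a) avg n (fun w => g (i :: w)) <= \sum_(i : K | i != a) b.
  apply: ler_sum => i _; apply: avg_le_cst => // w sw; by apply: gb; rewrite /= sw.
have h3 : \sum_(i : K | i != a) b = #|K|%:R * b - b.
  have <- : \sum_(i : K) b = #|K|%:R * b by rewrite sumr_const mulr_natl.
  by rewrite [in RHS](bigD1 a) //= addrAC subrr add0r.
have h4 : #|K|%:R ^- n.+1 * (b - g (a :: t)) * #|K|%:R = #|K|%:R ^- n * (b - g (a :: t)).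
  by rewrite exprS invfM; field; rewrite expf_neq0 ?gt_eqF.
rewrite mulrBl h4; move: h1 h2 h3 => /=; set X := _ ^- n * _; lra.
Qed.

(** By Markov's inequality the [v] with [d / 2 <= g v] have mass at least [d / 2], and each of them
    satisfies one of the [#|I|] properties. *)
Lemma fiber_pigeonhole (R : realType) (L I : finType) n (d : R) (g : seq L -> R)
    (P : I -> seq L -> Prop) :
  (0 < #|L|)%N -> 0 < d -> (forall v, size v = n -> g v <= 1) ->
  (forall v, size v = n -> d / 2 <= g v -> exists i, P i v) ->
  d <= avg n g ->
  exists i, d / 2 / #|I|%:R <= avg n (fun v => `[< P i v >]%:R).
Proof.
move=> L0 d0 g1 gP dg.
have le_sum : d / 2 <= \sum_i avg n (fun v => `[< P i v >]%:R).
  suff : avg n g <= d / 2 + \sum_i avg n (fun v => `[< P i v >]%:R) by lra.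
  rewrite -[X in X + _](@avg_cst R L n) // -avg_sum -avgD; apply: le_avg => v sv.
  have [dv|dv] := leP (d / 2) (g v); last first.
    by rewrite -[leLHS]addr0; apply: lerD; [exact: ltW|apply: sumr_ge0 => i _; rewrite ler0n].
  have [i Pi] := gP v sv dv.
  rewrite (bigD1 i) //=; have -> : `[< P i v >] by apply/asboolP.
  have : 0 <= \sum_(j | j != i) `[< P j v >]%:R :> R by apply: sumr_ge0 => j _; rewrite ler0n.
  by have := g1 v sv; rewrite mulr1n; lra.
apply: contrapT => nex.
have I0 : (0 < #|I|)%N.
  rewrite lt0n; apply/negP => /eqP/card0_eq I0.
  by move: le_sum; rewrite big_pred0 //; lra.
have : \sum_i avg n (fun v => `[< P i v >]%:R) < d / 2.
  have -> : d / 2 = \sum_(i : I) (d / 2 / #|I|%:R).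
    by rewrite sumr_const -[RHS]mulr_natr; field; rewrite pnatr_eq0 -lt0n.
  have [i _] := card_gt0P I0.
  apply: Num.Theory.ltr_sum => [|j _]; first by apply/hasP; exists i; rewrite ?mem_index_enum.
  by rewrite ltNge; apply/negP => ?; apply: nex; exists j.
by rewrite ltNge le_sum.
Qed.

(** * Combinatorial subspaces *)

Fixpoint words (K : finType) n : seq (seq K) :=
  if n is n'.+1 then [seq a :: w | a <- enum K, w <- words K n'] else [:: [::]].

Lemma mem_words (K : finType) n w : (w \in words K n) = (size w == n).
Proof.
elim: n w => [|n IH] [|a w] //=.
  by apply/negP => /allpairsP[[b v]] [].
apply/allpairsP/idP => [[[b v] /= [_ + [_ ->]]]|sw]; first by rewrite IH eqSS.
by exists (a, w); rewrite mem_enum IH.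
Qed.

Lemma words_uniq (K : finType) n : uniq (words K n).
Proof.
elim: n => //= n IH; apply: allpairs_uniq => //; first exact: enum_uniq.
by move=> [a u] [b v] _ _ /= [-> ->].
Qed.

Lemma avg_words (R : realType) (K : finType) n (f : seq K -> R) :
  avg n f = #|K|%:R ^- n * \sum_(w <- words K n) f w.
Proof.
elim: n f => [|n IH] f; first by rewrite /= big_seq1 expr0 invr1 mul1r.
rewrite [words _ _]/= big_allpairs_dep /= exprS invfM -mulrA; congr (_ * _).
rewrite mulr_sumr big_enum /=; apply: eq_bigr => a _; exact: IH.
Qed.

(* A template turns a word [w] of length [d] into a word whose letters are
   letters of [w] and constants of [K]; the map [K -> L] embeds the constants
   into the alphabet of [w], so that one template also acts on words over
   larger alphabets. *)
Definition template (K : eqType) : Type :=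
  forall L : eqType, (K -> L) -> seq L -> seq L.

(* By parametricity in [L], such a template is a combinatorial subspace of
   dimension [d] of the words of length [n] over [K]. *)
Record is_space (K : eqType) (d n : nat) (phi : template K) : Prop := IsSpace {
  space_size : forall (L : eqType) (i : K -> L) w,
    size w = d -> size (phi L i w) = n;
  space_map : forall (L L' : eqType) (i : K -> L) (g : L -> L') w,
    size w = d -> map g (phi L i w) = phi L' (g \o i) (map g w);
  space_mem : forall (L : eqType) (i : K -> L) w z,
    size w = d -> z \in w -> z \in phi L i w }.

Definition const_template (K : eqType) (u : seq K) : template K :=
  fun L i _ => map i u.

Lemma is_space_const (K : eqType) (u : seq K) :
  is_space 0 (size u) (const_template u).
Proof.
split=> [L i w _|L L' i g w _|L i w z /size0nil -> //].
  by rewrite size_map.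
by rewrite /const_template -map_comp.
Qed.

Definition id_template (K : eqType) : template K := fun L _ w => w.

Lemma is_space_id (K : eqType) d : is_space d d (@id_template K).
Proof. by split. Qed.

Definition line_template (K : eqType) (l : seq (option K)) : template K :=
  fun L i w => if w is z :: _ then map (oapp i z) l else [::].

Lemma is_space_line (K : eqType) (l : seq (option K)) :
  None \in l -> is_space 1 (size l) (line_template l).
Proof.
move=> Nl; split=> [L i [|z []] //= _|L L' i g [|z []] //= _|L i [|z []] // y _].
- by rewrite size_map.
- by rewrite -map_comp; apply: eq_map => -[].
- by rewrite inE => /eqP ->; apply/mapP; exists None.
Qed.

Definition cat_template (K : eqType) d (phi psi : template K) : template K :=
  fun L i w => phi L i (take d w) ++ psi L i (drop d w).

Lemma is_space_cat (K : eqType) d1 n1 d2 n2 (phi psi : template K) :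
  is_space d1 n1 phi -> is_space d2 n2 psi ->
  is_space (d1 + d2) (n1 + n2) (cat_template d1 phi psi).
Proof.
move=> [s1 m1 e1] [s2 m2 e2].
have szt (L : eqType) (w : seq L) : size w = (d1 + d2)%N -> size (take d1 w) = d1.
  by move=> sw; rewrite size_takel // sw leq_addr.
have szd (L : eqType) (w : seq L) : size w = (d1 + d2)%N -> size (drop d1 w) = d2.
  by move=> sw; rewrite size_drop sw addKn.
split=> [L i w sw|L L' i g w sw|L i w z sw].
- by rewrite size_cat s1 ?szt // s2 ?szd.
- by rewrite /cat_template map_cat m1 ?szt // m2 ?szd // map_take map_drop.
- rewrite -{1}(cat_take_drop d1 w) !mem_cat.
  by case/orP => [/e1 ->|/e2 ->]; rewrite ?szt ?szd ?orbT.
Qed.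

Definition comp_template (K : eqType) (phi psi : template K) : template K :=
  fun L i w => phi L i (psi L i w).

Lemma is_space_comp (K : eqType) d m n (phi psi : template K) :
  is_space m n phi -> is_space d m psi -> is_space d n (comp_template phi psi).
Proof.
move=> [s1 m1 e1] [s2 m2 e2]; rewrite /comp_template.
split=> [L i w sw|L L' i g w sw|L i w z sw zw].
- by rewrite s1 ?s2.
- by rewrite m1 ?m2 ?s2.
- by rewrite e1 ?s2 ?e2.
Qed.

Definition lift_template (K K' : eqType) (h : K -> K') (phi : template K) : template K' :=
  fun L i w => phi L (i \o h) w.

Lemma is_space_lift (K K' : eqType) (h : K -> K') d n (phi : template K) :
  is_space d n phi -> is_space d n (lift_template h phi).
Proof. by move=> [s m e]; split=> *; [apply: s|apply: m|apply: e]. Qed.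

(** By naturality every value of [phi] is obtained by evaluating one generic word [gen], whose
    letters are constants [inl] and coordinates [inr]. All coordinates occur in [gen], so the value
    determines the argument. *)
Lemma space_inj (K : eqType) d n (phi : template K) (L : eqType) (i : K -> L) w w' :
  is_space d n phi -> size w = d -> size w' = d -> phi L i w = phi L i w' -> w = w'.
Proof.
move=> sp sw; case: _ / sw sp; case: w => [|z w]; case: w' => [|z' w'] // [s m e] /= [sw'].
pose ev (u : seq L) (c : K + nat) := match c with inl a => i a | inr j => nth z u j end.
pose gen := phi (K + nat)%type inl (map inr (iota 0 (size w).+1)).
have genE u : size u = (size w).+1 -> phi L i u = map (ev u) gen.
  move=> su; rewrite m ?size_map ?size_iota -?map_comp //.
  apply: (congr1 (phi L i)); rewrite -[LHS](mkseq_nth z) su; exact: eq_map.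
rewrite !genE /= ?sw' // => /eq_in_map eqev.
apply: (@eq_from_nth _ z); rewrite /= ?sw' // => j jw.
apply: (eqev (inr j)); apply: e; rewrite ?size_map ?size_iota //.
by apply: map_f; rewrite mem_iota.
Qed.

Definition in_space (K : eqType) d (phi : template K) (u : seq K) : bool :=
  `[< exists2 w, size w = d & u = phi K id w >].

Lemma avg_in_space (R : realType) (K : finType) d n (phi : template K)
    (h : seq K -> R) :
  (0 < #|K|)%N -> is_space d n phi ->
  avg n (fun u => (in_space d phi u)%:R * h u) =
  avg n (fun u => (in_space d phi u)%:R) * avg d (h \o phi K id).
Proof.
move=> K0 sp.
have reindex (g : seq K -> R) : \sum_(u <- words K n) (in_space d phi u)%:R * g u =
    \sum_(w <- words K d) g (phi K id w).
  transitivity (\sum_(u <- words K n | in_space d phi u) g u).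
    rewrite [RHS]big_mkcond /=; apply: eq_bigr => u _.
    by case: in_space; rewrite ?mul1r ?mul0r.
  rewrite -(big_map (phi K id) xpredT g) -[LHS]big_filter; apply: perm_big.
  apply: uniq_perm; first by rewrite filter_uniq ?words_uniq.
    rewrite map_inj_in_uniq ?words_uniq // => u v; rewrite !mem_words => /eqP su /eqP sv.
    exact: space_inj sp su sv.
  move=> u; rewrite mem_filter mem_words; apply/andP/mapP.
    by case=> /asboolP[w sw ->] _; exists w; rewrite ?mem_words ?sw.
  case=> w; rewrite mem_words => /eqP sw ->.
  by split; [apply/asboolP; exists w|rewrite (space_size sp)].
have k0 : #|K|%:R != 0 :> R by rewrite pnatr_eq0 -lt0n.
have := reindex (fun=> 1); under eq_bigr do rewrite mulr1; move=> E1.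
rewrite !avg_words reindex E1 mulrACA mulrA; congr (_ * _).
have -> : \sum_(w <- words K d) 1 = #|K|%:R ^+ d :> R.
  have := @avg_cst R K d 1 K0; rewrite avg_words => H.
  by rewrite -[LHS](mulVKf (expf_neq0 d k0)) H mulr1.
by rewrite -mulrA mulVf ?mulr1 ?expf_neq0.
Qed.

Lemma avg_in_space_ge (R : realType) (K : finType) d n (phi : template K) :
  (0 < #|K|)%N -> is_space d n phi ->
  #|K|%:R ^- n <= avg n (fun u => (in_space d phi u)%:R) :> R.
Proof.
move=> K0 sp; have [a _] := card_gt0P K0.
have sw : size (nseq d a) = d by rewrite size_nseq.
rewrite avg_words -{1}[_ ^- _]mulr1 ler_wpM2l ?invr_ge0 ?exprn_ge0 //.
rewrite (bigD1_seq (phi K id (nseq d a))) ?words_uniq //=; last first.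
  by rewrite mem_words (space_size sp).
have -> : in_space d phi (phi K id (nseq d a)) by apply/asboolP; exists (nseq d a).
by rewrite lerDl; apply: sumr_ge0 => *.
Qed.

(** * Density Hales-Jewett: subspaces and biased measures *)

Definition has_line (K : finType) n (A : pred (seq K)) : Prop :=
  exists l : seq (option K),
    [/\ size l = n, None \in l & forall a, A (map (odflt a) l)].

Definition forces_line (R : realType) (K : finType) (d : R) : Prop :=
  exists n, forall A : pred (seq K), d <= avg n (fun w => (A w)%:R) -> has_line n A.

Definition density_hales_jewett (R : realType) (K : finType) : Prop :=
  forall d : R, 0 < d -> forces_line K d.

Lemma exists_expr_le (R : realType) (q e : R) :
  0 <= q -> q < 1 -> 0 < e -> exists n, q ^+ n <= e.
Proof.
move=> q0 q1 e0; have q1' : `|q| < 1 by rewrite ger0_norm.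
have /cvgrPdist_le /(_ e e0) [n _ /(_ n (leqnn n))] := cvg_expr q1'.
by rewrite /= sub0r normrN ger0_norm ?exprn_ge0 // => ?; exists n.
Qed.

Lemma sum_option (R : realType) (K : finType) (F : option K -> R) :
  \sum_x F x = F None + \sum_a F (Some a).
Proof.
rewrite (bigD1 None) //=; congr (_ + _).
rewrite (reindex_omap Some id) => [|[]//] /=.
by apply: eq_bigl => a; rewrite eqxx.
Qed.

(** Dense fibers over the last [n2] letters contain lines; a line common to a dense set of [v] is
    fixed by pigeonhole, and induction applies to that set. The finite family [Phi] is chosen before
    [A], so that later arguments can pigeonhole over it. *)
Lemma multidim_density_hales_jewett (R : realType) (K : finType) :
  (0 < #|K|)%N -> density_hales_jewett R K -> forall m (d : R), 0 < d ->
  exists n (I : finType) (Phi : I -> template K), forall A : pred (seq K),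
    d <= avg n (fun w => (A w)%:R) ->
    exists i, is_space m n (Phi i) /\ forall w, size w = m -> A (Phi i K id w).
Proof.
move=> K0 DHJ; elim=> [|m IH] d d0.
  exists 0, unit, (fun=> const_template [::]) => A /= dA; exists tt; split.
    exact: (is_space_const [::]).
  by move=> w _ /=; move: dA; case: (A [::]) => //; rewrite leNgt d0.
have [n1 n1P] := DHJ _ (divr_gt0 d0 (ltr0n _ 2)).
pose I1 := n1.-tuple (option K).
have I1_gt0 : (0 < #|{: I1}|)%N.
  by rewrite card_tuple expn_gt0 card_option.
have d2 : 0 < d / 2 / #|{: I1}|%:R by rewrite !divr_gt0 ?ltr0n.
have [n2 [I2 [Phi2 n2P]]] := IH _ d2.
exists (n1 + n2)%N, (I1 * I2)%type,
  (fun i : I1 * I2 => cat_template 1 (line_template i.1) (Phi2 i.2)) => A.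
rewrite avg_cat exchange_avg => dA.
have [|v sv|l dl] := @fiber_pigeonhole R K I1 n2 d _
  (fun l v => None \in l /\ forall a, A (map (odflt a) l ++ v)) K0 d0 _ _ dA.
- by move=> v sv; apply: avg_le_cst => // w _; case: (A _).
- by move=> /(n1P (fun u => A (u ++ v))) [l [/eqP sl Nl lA]]; exists (Tuple sl).
have [i [sp iP]] := n2P (fun v => `[< None \in l /\ forall a, A (map (odflt a) l ++ v) >]) dl.
have lP w : size w = m -> None \in l /\ forall a, A (map (odflt a) l ++ Phi2 i K id w).
  by move=> /iP /asboolP.
have [a _] := card_gt0P K0.
have [Nl _] := lP (nseq m a) (size_nseq _ _).
exists (l, i); split.
  have := is_space_line Nl; rewrite size_tuple => sl.
  exact: (is_space_cat sl sp).
move=> [//|b w] /= [sw]; rewrite /cat_template /= drop0.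
by have [_] := lP w sw; apply.
Qed.

(** The first letter of [x] other than [None] is uniform on [K], so it sweeps out a line, on which
    the average is at most [t]. Only the word made of [None] alone escapes; its mass is the error
    term. *)
Lemma biased_line (R : realType) (K : finType) (a : K) n (t : R) (g : seq K -> R) :
  (forall w, g w <= 1) -> 0 <= t ->
  (forall l, size l = n -> None \in l ->
    avg 1 (fun w => g (line_template l id w)) <= t) ->
  avg n (fun x : seq (option K) => g (map (odflt a) x)) <= t + #|{: option K}|%:R ^- n.
Proof.
move=> + t0; elim: n g => [|n IH] g g1 gt /=.
  by rewrite expr0 invr1; have := g1 [::]; lra.
have k0 : 0 < #|K|%:R :> R by rewrite ltr0n; apply/card_gt0P; exists a.
have h1 := IH (fun w => g (a :: w)) (fun w => g1 _).
have {}h1 : avg n (fun x : seq (option K) => g (a :: map (odflt a) x)) <=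
    t + #|{: option K}|%:R ^- n.
  by apply: h1 => l sl Nl; apply: (gt (Some a :: l)); rewrite /= ?sl.
have h2 : \sum_b avg n (fun x : seq (option K) => g (b :: map (odflt a) x)) <= #|K|%:R * t.
  rewrite -avg_sum; apply: avg_le_cst; first by rewrite card_option.
  move=> x sx; rewrite -ler_pdivrMl //.
  have := gt (None :: map (Some \o odflt a) x); rewrite /= size_map sx => /(_ erefl erefl).
  by under eq_bigr do rewrite -map_comp.
rewrite sum_option /= mulrC ler_pdivrMr ?ltr0n ?card_option //.
rewrite exprS invfM mulrDl; move: h1 h2; rewrite card_option.
set X := _ ^- n => h1 h2.
have -> : (#|K|.+1%:R^-1 * X) * #|K|.+1%:R = X by rewrite mulrAC mulVf ?mul1r ?pnatr_eq0.
rewrite -natr1; lra.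
Qed.

(** Induction gives a subspace in the last [n2] letters for the average [G] over the first block.
    Then [biased_line] gives a line in the first block, along which the average over that subspace
    loses at most [e / 2]. *)
Lemma biased_space (R : realType) (K : finType) (a : K) m (e : R) : 0 < e ->
  exists n (I : finType) (Phi : I -> template K), forall F : seq K -> R,
    (forall w, 0 <= F w <= 1) ->
    exists i, is_space m n (Phi i) /\
      avg n (fun x : seq (option K) => F (map (odflt a) x)) - e <=
      avg m (fun w => F (Phi i K id w)).
Proof.
elim: m e => [|m IH] e e0.
  exists 0, unit, (fun=> const_template [::]) => F _; exists tt; split.
    exact: (is_space_const [::]).
  by rewrite /= /const_template /=; lra.
have K0 : (0 < #|K|)%N by apply/card_gt0P; exists a.
have q1 : (#|{: option K}|%:R^-1 : R) < 1 by rewrite card_option invf_lt1 ?ltr1n ?ltr0n.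
have e4 : 0 < e / 4 by lra.
have q0 : 0 <= (#|{: option K}|%:R^-1 : R) by rewrite invr_ge0.
have [n1 n1e] := exists_expr_le q0 q1 e4.
have {}n1e : #|{: option K}|%:R ^- n1.+1 <= e / 4 :> R.
  by rewrite -exprVn exprS; apply: le_trans n1e; apply: ler_piMl; [exact: exprn_ge0|exact: ltW].
have [n2 [I2 [Phi2 n2P]]] := IH (e / 2) ltac:(lra).
pose I1 := n1.+1.-tuple (option K).
exists (n1.+1 + n2)%N, (I1 * I2)%type,
  (fun i : I1 * I2 => cat_template 1 (line_template i.1) (Phi2 i.2)) => F F01.
have O0 : (0 < #|{: option K}|)%N by rewrite card_option.
pose G z := avg n1.+1 (fun u : seq (option K) => F (map (odflt a) u ++ z)).
have [|i [sp iP]] := n2P G.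
  move=> z; rewrite avg_ge0 => [|w _]; last by case/andP: (F01 (map (odflt a) w ++ z)).
  by rewrite avg_le_cst // => w _; case/andP: (F01 (map (odflt a) w ++ z)).
pose g u := avg m (fun w => F (u ++ Phi2 i K id w)).
have g0 u : 0 <= g u by apply: avg_ge0 => w _; case/andP: (F01 (u ++ Phi2 i K id w)).
have g1 u : g u <= 1.
  by apply: avg_le_cst => // w _; case/andP: (F01 (u ++ Phi2 i K id w)).
pose t := avg n1.+1 (fun x : seq (option K) => g (map (odflt a) x)) - e / 2.
have [l [sl Nl lt]] : exists l : seq (option K),
    [/\ size l = n1.+1, None \in l & t <= avg 1 (fun w => g (line_template l id w))].
  apply: contrapT => nex.
  have lt l : size l = n1.+1 -> None \in l -> avg 1 (fun w => g (line_template l id w)) < t.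
    by move=> sl Nl; rewrite ltNge; apply/negP => ?; apply: nex; exists l.
  (* [biased_line] asks for a nonnegative bound; for negative [t] any line will do, since [g] is
     nonnegative. *)
  have [t0|t0] := leP 0 t; last first.
    have := lt (nseq n1.+1 None) (size_nseq _ _) (mem_head _ _).
    by rewrite ltNge (le_trans (ltW t0)) // avg_ge0.
  have := @biased_line R K a n1.+1 t g g1 t0 (fun l sl Nl => ltW (lt l sl Nl)).
  rewrite {1}/t in t0 *; rewrite /t; move: n1e; set X := _ ^- _; set Y := avg _ _; lra.
have sl' : size l == n1.+1 by rewrite sl.
exists (Tuple sl', i); split.
  by have := is_space_line Nl; rewrite sl => /is_space_cat; apply.
have -> : avg (n1.+1 + n2) (fun x : seq (option K) => F (map (odflt a) x)) =
    avg n2 (fun z : seq (option K) => G (map (odflt a) z)).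
  rewrite avg_cat exchange_avg; apply: eq_avg => z _; apply: eq_avg => u _.
  by rewrite map_cat.
have E1 : avg m (fun w => G (Phi2 i K id w)) = t + e / 2.
  by rewrite /t subrK exchange_avg.
have E2 : avg 1 (fun w => g (line_template l id w)) =
   avg (1 + m) (fun w => F (cat_template 1 (line_template l) (Phi2 i) id w)).
  rewrite avg_cat; apply: eq_avg => -[|b []] //= _; apply: eq_avg => w _.
  by rewrite /cat_template /= drop0.
by move: iP lt; rewrite E1 E2 /=; lra.
Qed.

(* The measure on words over [K] here is biased: the letter [a] has weight 2. *)
Lemma biased_density_hales_jewett (R : realType) (K : finType) (a : K) :
  density_hales_jewett R K -> forall m (d : R), 0 < d ->
  exists n (I : finType) (Phi : I -> template K), forall A : pred (seq K),
    d <= avg n (fun x : seq (option K) => (A (map (odflt a) x))%:R) ->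
    exists i, is_space m n (Phi i) /\ forall w, size w = m -> A (Phi i K id w).
Proof.
move=> DHJ m d d0.
have K0 : (0 < #|K|)%N by apply/card_gt0P; exists a.
have d2 : 0 < d / 2 by lra.
have [n1 [I1 [Phi1 n1P]]] := multidim_density_hales_jewett K0 DHJ m d2.
have [n2 [I2 [Phi2 n2P]]] := biased_space a n1 d2.
exists n2, (I2 * I1)%type, (fun i => comp_template (Phi2 i.1) (Phi1 i.2)) => A dA.
have [|i [sp iP]] := n2P (fun w => (A w)%:R).
  by move=> w; case: (A w); rewrite /= ?ler01 ?lexx.
have [|j [sp' jP]] := n1P (fun w => A (Phi2 i K id w)); first by lra.
exists (i, j); split; first exact: is_space_comp sp sp'.
exact: jP.
Qed.

(** * Insensitive sets *)

(** [odflt a] identifies [None] with [Some a], so [D] is determined by its words over [K]. There [a]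
    is hit by two letters of [option K], which is where the biased averages come from. *)
Definition insensitive (K : finType) (a : K) (D : pred (seq (option K))) : Prop :=
  forall x y, map (odflt a) x = map (odflt a) y -> D x = D y.

Lemma map_odflt_Some (K : Type) (a : K) w : map (odflt a) (map Some w) = w.
Proof. by rewrite -map_comp map_id. Qed.

Lemma map_odflt_space (K : eqType) (a : K) d n (phi : template K) x :
  is_space d n phi -> size x = d ->
  map (odflt a) (phi (option K) Some x) = phi K id (map (odflt a) x).
Proof. by move=> sp sx; rewrite (space_map sp). Qed.

Lemma ler_indic (R : realType) (b : bool) (x : R) : x <= 1 -> b%:R * x <= b%:R.
Proof. by case: b; rewrite ?mul1r ?mul0r. Qed.

(* Remove from [D], [q] times, a product of a [d]-dimensional subspace of the
   next [M] coordinates with a dense set of completions: each removal lowers the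
   density by the factor [1 - z] unless it is below [e] already. *)
Lemma insensitive_cover (R : realType) (K : finType) (a : K) M d (I : finType)
    (Phi : I -> template K) (e z : R) :
  0 < e -> z = #|{: option K}|%:R ^- M * (e / 2 / #|I|.+1%:R) -> z <= 1 ->
  (forall A : pred (seq K),
    e / 2 <= avg M (fun x : seq (option K) => (A (map (odflt a) x))%:R) ->
    exists i, is_space d M (Phi i) /\ forall w, size w = d -> A (Phi i K id w)) ->
  forall q (D : pred (seq (option K))) f (b : R), insensitive a D ->
  (forall x, f x <= 1) -> 0 <= b ->
  (forall phi : template (option K), is_space d (q * M) phi ->
     (forall w, size w = d -> D (phi _ id w)) ->
     avg d (fun w => f (phi _ id w)) <= b) ->
  avg (q * M) (fun x => (D x)%:R * f x) <=
  b * avg (q * M) (fun x => (D x)%:R) + e + (1 - z) ^+ q * avg (q * M) (fun x => (D x)%:R).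
Proof.
move=> e0 zE z1 PhiP; elim=> [|q IH] D f b Di f1 b0 fb.
  rewrite /= expr0 mul1r.
  have := ler_indic (D [::]) (f1 [::]); have : 0 <= (D [::])%:R :> R by [].
  by move=> D0 h; have := mulr_ge0 b0 D0; lra.
have O0 : (0 < #|{: option K}|)%N by rewrite card_option.
have D1 n (E : pred (seq (option K))) : avg n (fun x => (E x)%:R) <= 1 :> R.
  by apply: avg_le_cst => // x _; case: (E x).
have D0 n (E : pred (seq (option K))) : 0 <= avg n (fun x => (E x)%:R) :> R.
  by apply: avg_ge0.
set dD := avg _ (fun x => (D x)%:R).
have [De|De] := leP dD e.
  have : avg (q.+1 * M) (fun x => (D x)%:R * f x) <= dD.
    by apply: le_avg => x _; apply: ler_indic.
  have : 0 <= (1 - z) ^+ q.+1 * dD by rewrite mulr_ge0 ?D0 // exprn_ge0 // subr_ge0.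
  by have := mulr_ge0 b0 (D0 (q.+1 * M)%N D); rewrite -/dD; lra.
have {}De : e <= avg (q * M) (fun v => avg M (fun u => (D (u ++ v))%:R)).
  by move: (ltW De); rewrite /dD mulSn avg_cat exchange_avg.
pose P i v := is_space d M (Phi i) /\ forall w, size w = d -> D (Phi i _ Some w ++ v).
have [|v sv gv|i] := @fiber_pigeonhole R _ I _ e _ P O0 e0 _ _ De.
- by move=> v _; exact: (D1 M (fun u => D (u ++ v))).
- have [|i [sp iP]] := PhiP (fun w => D (map Some w ++ v)).
    apply: le_trans gv _; apply: le_avg => u _.
    by rewrite (Di _ (u ++ v)) // !map_cat map_odflt_Some.
  exists i; split => // x sx; rewrite (Di _ (map Some (Phi i K id (map (odflt a) x)) ++ v)).
    by apply: iP; rewrite size_map.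
  by rewrite !map_cat map_odflt_Some (map_odflt_space a sp).
set Y := fun v => `[< P i v >] => Yd.
have I0 : (0 < #|I|)%N by apply/card_gt0P; exists i.
have [v0 _ Yv0] := avg_ex O0 Yd.
have sp : is_space d M (Phi i).
  have : 0 < (Y v0)%:R :> R by apply: lt_le_trans Yv0; rewrite !divr_gt0 ?ltr0n.
  by rewrite /Y; case: asboolP => [[]|]; rewrite ?ltxx.
pose psi := lift_template Some (Phi i).
have sp' : is_space d M psi by exact: is_space_lift.
pose V := in_space d psi.
have VY u v : V u -> Y v -> D (u ++ v).
  by move=> /asboolP[w sw ->] /asboolP[_]; apply.
pose D' u v := D (u ++ v) && ~~ (V u && Y v).
(* For fixed [u] the remainder stays insensitive in [v], because [Y] is; the induction hypothesis
   can thus be applied fiber by fiber. *)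
have D'i u : insensitive a (D' u).
  move=> x y xy; rewrite /D' /Y; congr (_ && ~~ (_ && _)).
    by apply: Di; rewrite !map_cat xy.
  apply: asbool_equiv_eq; split=> -[? H]; split=> // w sw.
    by rewrite (Di _ (Phi i _ Some w ++ x)) ?H // !map_cat xy.
  by rewrite (Di _ (Phi i _ Some w ++ y)) ?H // !map_cat xy.
have splitD (h : seq (option K) -> R) : avg (M + q * M) (fun x => (D x)%:R * h x) =
  avg (q * M) (fun v => (Y v)%:R * avg M (fun u => (V u)%:R * h (u ++ v))) +
  avg M (fun u => avg (q * M) (fun v => (D' u v)%:R * h (u ++ v))).
  rewrite [X in _ = _ + X]exchange_avg avg_cat exchange_avg -avgD; apply: eq_avg => v _.
  rewrite -avgZ -avgD; apply: eq_avg => u _; rewrite /D'.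
  have := VY u v; case: (V u) (Y v) (D (u ++ v)) => [] [] [] //=;
    rewrite ?mul1r ?mul0r ?addr0 ?add0r //.
  by move=> /(_ isT isT).
have c0 := avg_in_space_ge R O0 sp'.
set c := avg M (fun u => (V u)%:R : R) in c0.
set y := avg (q * M) (fun v => (Y v)%:R) in Yd.
have splitD1 : dD = c * y + avg M (fun u => avg (q * M) (fun v => (D' u v)%:R)) :> R.
  transitivity (avg (M + q * M) (fun x => (D x)%:R * 1 : R)).
    by apply: eq_avg => x _; rewrite mulr1.
  rewrite splitD /y -avgZ; congr (_ + _).
    apply: eq_avg => v _; rewrite mulrC; congr (_ * _).
    by apply: eq_avg => u _; rewrite mulr1.
  by apply: eq_avg => u _; apply: eq_avg => v _; rewrite mulr1.
have bound1 : avg (q * M) (fun v => (Y v)%:R * avg M (fun u => (V u)%:R * f (u ++ v)))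
    <= b * (c * y).
  rewrite /y -!avgZ; apply: le_avg => v sv.
  rewrite avg_in_space //; rewrite -/V -/c.
  case Yv : (Y v); rewrite ?mul0r ?mulr0 // mul1r mulr1n mulr1 mulrC ler_wpM2r //.
    by apply: le_trans c0; rewrite invr_ge0 exprn_ge0.
  have cvE w : size w = d -> cat_template d psi (const_template v) id w = psi _ id w ++ v.
    by move=> sw; rewrite /cat_template take_oversize ?sw // /const_template map_id.
  have -> : avg d ((fun u => f (u ++ v)) \o psi (option K) id) =
      avg d (fun w => f (cat_template d psi (const_template v) id w)).
    by apply: eq_avg => w sw; rewrite /= cvE.
  apply: fb => [|w sw]; last by rewrite cvE //; apply: VY => //; apply/asboolP; exists w.
  rewrite mulSn -[X in is_space X](addn0 d) -sv; apply: is_space_cat => //.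
  exact: is_space_const.
have bound2 : avg M (fun u => avg (q * M) (fun v => (D' u v)%:R * f (u ++ v))) <=
    (b + (1 - z) ^+ q) * (dD - c * y) + e.
  rewrite splitD1 addrAC subrr add0r -avgZ -[X in _ + X](avg_cst M e O0) -avgD.
  apply: le_avg => u su.
  have -> : (b + (1 - z) ^+ q) * avg (q * M) (fun v => (D' u v)%:R) + e =
    b * avg (q * M) (fun v => (D' u v)%:R) + e + (1 - z) ^+ q * avg (q * M) (fun v => (D' u v)%:R).
    by ring.
  apply: IH => // phi sph phiD'.
  have cuE w : cat_template 0 (const_template u) phi id w = u ++ phi _ id w.
    by rewrite /cat_template drop0 /const_template map_id.
  have -> : avg d (fun w => f (u ++ phi (option K) id w)) =
      avg d (fun w => f (cat_template 0 (const_template u) phi id w)).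
    by apply: eq_avg => w sw; rewrite cuE.
  apply: fb => [|w sw]; last by rewrite cuE; case/andP: (phiD' _ sw).
  by rewrite mulSn -[X in (X + _)%N]su; exact: (is_space_cat (is_space_const u) sph).
(* The removed product has mass [c * y], which is at least [z], while [D] has density at most 1. *)
have zcy : z * dD <= c * y.
  apply: (@le_trans _ _ z).
    rewrite -[leRHS]mulr1 ler_wpM2l ?D1 // zE mulr_ge0 ?invr_ge0 ?exprn_ge0 //.
    by rewrite !divr_ge0 // ltW.
  rewrite zE; apply: ler_pM => //.
    by rewrite !divr_ge0 // ltW.
  apply: le_trans Yd; rewrite ler_pM2l ?divr_gt0 // lef_pV2 ?posrE ?ltr0n // ler_nat.
  exact: leqnSn.
have : (1 - z) ^+ q * (dD - c * y) <= (1 - z) ^+ q.+1 * dD.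
  rewrite exprSr -mulrA ler_wpM2l ?exprn_ge0 ?subr_ge0 //; lra.
by rewrite mulSn splitD; lra.
Qed.

Lemma avg_restrict (R : realType) (K : finType) m m' (f : seq K -> R) c :
  (0 < #|K|)%N -> (m <= m')%N -> c <= avg m' f ->
  exists2 v, size v = (m' - m)%N & c <= avg m (fun u => f (u ++ v)).
Proof. by move=> K0 mm'; rewrite -{1}(subnKC mm') avg_cat exchange_avg => /avg_ex; apply. Qed.

Lemma is_space_const_cat (K : eqType) m m' (v : seq K) : (m <= m')%N ->
  size v = (m' - m)%N ->
  is_space m m' (cat_template m (@id_template K) (const_template v)).
Proof.
move=> mm' sv; rewrite -[X in is_space X](addn0 m) -[X in is_space _ X](subnKC mm') -sv.
by apply: is_space_cat; [exact: is_space_id|exact: is_space_const].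
Qed.

Lemma id_const_catE (K : eqType) m (v w : seq K) : size w = m ->
  cat_template m (@id_template K) (const_template v) id w = w ++ v.
Proof.
by move=> sw; rewrite /cat_template /id_template take_oversize ?sw // /const_template map_id.
Qed.

(** Otherwise [f] has average at most [e / 2] on all [d]-dimensional subspaces inside [D]. After the
    surplus letters are fixed, [insensitive_cover] bounds the average by [e / 2 + e / 8 + e / 8],
    less than [e]. *)
Lemma insensitive_increment (R : realType) (K : finType) (a : K) :
  density_hales_jewett R K -> forall d (e : R), 0 < e ->
  exists m, forall m', (m <= m')%N -> forall (D : pred (seq (option K))) f,
  insensitive a D -> (forall x, f x <= 1) ->
  e <= avg m' (fun x => (D x)%:R * f x) ->
  exists phi : template (option K), is_space d m' phi /\
    e / 2 <= avg d (fun w => f (phi _ id w)).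
Proof.
move=> DHJ d e e0.
have e8 : 0 < e / 8 by lra.
have e16 : 0 < e / 8 / 2 by lra.
have O0 : (0 < #|{: option K}|)%N by rewrite card_option.
have [M [I [Phi PhiP]]] := biased_density_hales_jewett a DHJ d e16.
pose z := #|{: option K}|%:R ^- M * (e / 8 / 2 / #|I|.+1%:R).
(* [1 < z] would need [e] above 1, which is incompatible with the lower bound on the average. *)
have [z1|z1] := leP z 1; last first.
  have Mz : #|{: option K}|%:R ^- M <= 1 :> R.
    rewrite invf_le1 ?exprn_gt0 ?ltr0n // exprn_ege1 // ler1n //.
  exists 0 => m' _ D f _ f1 ef; exfalso.
  have e1 : e <= 1.
    apply: le_trans ef _; apply: avg_le_cst => // x _.
    by apply: le_trans (ler_indic _ (f1 x)) _; case: (D x).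
  have : z <= 1 * (e / 8 / 2).
    apply: ler_pM => //; rewrite ?invr_ge0 ?exprn_ge0 ?divr_ge0 ?(ltW e0) //.
    by rewrite ler_pdivrMr ?ltr0n // ler_peMr ?ler1n // ltW.
  by lra.
have z0 : 0 < z by rewrite mulr_gt0 ?invr_gt0 ?exprn_gt0 ?divr_gt0 ?ltr0n.
have [q qP] := exists_expr_le (ltac:(lra) : 0 <= 1 - z) (ltac:(lra) : 1 - z < 1) e8.
exists (q * M)%N => m' mm' D f Di f1 ef.
have [v sv {}ef] := avg_restrict O0 mm' ef.
apply: contrapT => nex.
have e2 : 0 <= e / 2 by lra.
have Dvi : insensitive a (fun x => D (x ++ v)).
  by move=> x y xy; apply: Di; rewrite !map_cat xy.
have dD1 : avg (q * M) (fun x => (D (x ++ v))%:R : R) <= 1.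
  by apply: avg_le_cst => // x _; case: (D _).
have dD0 : 0 <= avg (q * M) (fun x => (D (x ++ v))%:R : R) by apply: avg_ge0.
have fb (phi : template (option K)) : is_space d (q * M) phi ->
    (forall w, size w = d -> D (phi (option K) id w ++ v)) ->
    avg d (fun w => f (phi (option K) id w ++ v)) <= e / 2.
  move=> sp phiD; rewrite leNgt; apply/negP => lt_e; apply: nex.
  exists (comp_template (cat_template (q * M) (@id_template _) (const_template v)) phi); split.
    exact: is_space_comp (is_space_const_cat mm' sv) sp.
  apply: le_trans (ltW lt_e) _; apply: le_avg => w sw.
  by rewrite /comp_template id_const_catE // (space_size sp).
have := @insensitive_cover R K a M d I Phi (e / 8) z e8 erefl z1 PhiP q
  (fun x => D (x ++ v)) (fun x => f (x ++ v)) (e / 2) Dvi (fun x => f1 _) e2 fb.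
move: ef dD0 dD1; set X := avg _ _; set Y := avg _ _ => h1 h2 h3.
have h4 : (1 - z) ^+ q * Y <= e / 8 * 1 by rewrite ler_pM // exprn_ge0 //; lra.
have : e / 2 * Y <= e / 2 * 1 by rewrite ler_pM2l //; lra.
lra.
Qed.

(** The complement of the intersection splits into [~~ C a] and the part of [C a] outside the
    remaining sets. If the first carries half of the average, it is insensitive itself; if the
    second does, [insensitive_increment] leads to a subspace where only the remaining sets occur. *)
Lemma intersection_increment (R : realType) (K : finType) :
  density_hales_jewett R K -> forall (s : seq K) d (e : R), 0 < e ->
  exists m (e' : R), 0 < e' /\ forall m', (m <= m')%N ->
  forall (C : K -> pred (seq (option K))) f,
  (forall a, insensitive a (C a)) -> (forall x, f x <= 1) ->
  e <= avg m' (fun x => (~~ all (C^~ x) s)%:R * f x) ->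
  exists phi : template (option K), is_space d m' phi /\
    e' <= avg d (fun w => f (phi _ id w)).
Proof.
move=> DHJ; elim=> [|a s IH] d e e0.
  exists 0, 1; split=> // m' _ C f _ _ /=.
  under eq_avg do rewrite mul0r.
  by rewrite avg0 leNgt e0.
have e2 : 0 < e / 2 by lra.
have e4 : 0 < e / 2 / 2 by lra.
have O0 : (0 < #|{: option K}|)%N by rewrite card_option.
have [m1 [e' [e'0 m1P]]] := IH d _ e4.
have [m mP] := insensitive_increment a DHJ (maxn m1 d) e2.
exists m, (Num.min e' (e / 2 / 2)); split; first by rewrite lt_min e'0.
move=> m' mm' C f Ci f1 ef.
have splitC : avg m' (fun x => (~~ all (C^~ x) (a :: s))%:R * f x) =
    avg m' (fun x => (~~ C a x)%:R * f x) +
    avg m' (fun x => (C a x)%:R * ((~~ all (C^~ x) s)%:R * f x)).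
  rewrite -avgD; apply: eq_avg => x _ /=.
  by case: (C a x); rewrite /= ?mul1r ?mul0r ?addr0 ?add0r.
have [le1|lt1] := leP (e / 2) (avg m' (fun x => (~~ C a x)%:R * f x)).
  have [|phi [sp fphi]] := mP m' mm' (fun x => ~~ C a x) f _ f1 le1.
    by move=> x y xy; rewrite (Ci a x y xy).
  have [v sv fv] := avg_restrict O0 (leq_maxr m1 d) fphi.
  exists (comp_template phi (cat_template d (@id_template _) (const_template v))); split.
    exact: is_space_comp sp (is_space_const_cat (leq_maxr m1 d) sv).
  apply: (@le_trans _ _ (e / 2 / 2)); first by rewrite ge_min lexx orbT.
  apply: le_trans fv _; apply: le_avg => w sw.
  by rewrite /comp_template id_const_catE.
have le2 : e / 2 <= avg m' (fun x => (C a x)%:R * ((~~ all (C^~ x) s)%:R * f x)).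
  by move: ef; rewrite splitC; lra.
have [|phi [sp fphi]] := mP m' mm' (C a) (fun x => (~~ all (C^~ x) s)%:R * f x) (Ci a) _ le2.
  by move=> x; apply: le_trans (ler_indic _ (f1 x)) _; case: (~~ _).
set d' := maxn m1 d in phi sp fphi.
(* [phi] is controlled only on words of length [d']; the size test makes [C'] insensitive on all
   words. *)
pose C' b x := C b (phi _ id x) && (size x == d').
have C'i b : insensitive b (C' b).
  move=> x y xy; have /(congr1 size) := xy; rewrite !size_map /C' => sxy.
  have [sx|sx] := eqVneq (size x) d'; last by rewrite -sxy (negbTE sx) !andbF.
  rewrite -sxy sx eqxx (Ci b _ (phi _ id y)) //.
  by rewrite (space_map sp) // xy -(space_map sp) // -sxy.
have [|phi' [sp' fphi']] := m1P _ (leq_maxl m1 d) C' (fun x => f (phi _ id x)) C'i (fun x => f1 _).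
  apply: le_trans fphi _; apply: le_avg => x sx.
  by rewrite /C' (eq_all (a2 := C^~ (phi _ id x))) // => b; rewrite sx eqxx andbT.
exists (comp_template phi phi'); split; first exact: is_space_comp sp sp'.
by apply: le_trans fphi'; rewrite ge_min lexx.
Qed.

(** * Colouring theorems *)

(** The colour of a word [w] is the set of [i] with [f i w], so that one line serves many
    two-colourings at once. *)
Definition hales_jewett (K : finType) : Prop := forall I : finType,
  exists n, forall f : I -> pred (seq K), exists l : seq (option K),
  [/\ size l = n, None \in l &
      forall i a b, f i (map (odflt a) l) = f i (map (odflt b) l)].

Lemma hales_jewett_of_density (R : realType) (K : finType) :
  (0 < #|K|)%N -> density_hales_jewett R K -> hales_jewett K.
Proof.
move=> K0 DHJ I; pose C := {ffun I -> bool}.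
have C0 : (0 < #|{: C}|)%N by rewrite card_ffun card_bool expn_gt0.
have d0 : 0 < 1 / 2 / #|{: C}|%:R :> R by rewrite !divr_gt0 ?ltr0n.
have [n nP] := DHJ _ d0; exists n => f.
pose col w : C := [ffun i => f i w].
have [|||c] := @fiber_pigeonhole R K C n 1 (fun=> 1) (fun c w => col w = c) K0 ltr01.
- by [].
- by move=> w _ _; exists (col w).
- by rewrite avg_cst.
move=> /(nP (fun w => `[< col w = c >])) [l [sl Nl lc]]; exists l; split=> // i a b.
have E d : f i (map (odflt d) l) = c i.
  by have /asboolP <- := lc d; rewrite ffunE.
by rewrite !E.
Qed.

(** Among the [n + 1] words [u j], two have the same colour, since there are only [n] colours. They
    are the two points of a line whose variable positions are those between [j] and [j']. *)
Lemma hales_jewett_bool : hales_jewett bool.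
Proof.
move=> I; pose C := {ffun I -> bool}; set n := #|{: C}|; exists n => f.
pose u j := nseq j false ++ nseq (n - j) true.
pose col (j : 'I_n.+1) : C := [ffun i => f i (u j)].
have /injectivePn [j [j' jj' cc]] : ~~ injectiveb col.
  by apply/negP => /injectiveP/leq_card; rewrite card_ord ltnn.
wlog lt_jj : j j' jj' cc / (j < j')%N.
  move=> H; have [/H|/H|/val_inj E] := ltngtP j j'; first exact.
    by apply; rewrite // eq_sym.
  by rewrite E eqxx in jj'.
have j'n : (j' <= n)%N by rewrite -ltnS.
exists (nseq j (Some false) ++ nseq (j' - j) None ++ nseq (n - j') (Some true)); split.
- by rewrite !size_cat !size_nseq; lia.
- rewrite !mem_cat; apply/orP; right; apply/orP; left.
  by rewrite mem_nseq eqxx subn_gt0 lt_jj.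
have E b : map (odflt b) (nseq j (Some false) ++ nseq (j' - j) None ++ nseq (n - j') (Some true))
    = u (if b then j else j').
  rewrite !map_cat !map_nseq /u /=; case: b.
    by rewrite -nseqD; congr (_ ++ nseq _ _); lia.
  by rewrite catA -nseqD subnKC // ltnW.
move=> i a b; rewrite !E.
have /ffunP /(_ i) := cc; rewrite !ffunE => fi.
by case: a b => [] [].
Qed.

(** The colour is made independent of changes that [p] does not see, one coordinate at a time. The
    later coordinates are found first, for all prefixes of length [P + n1]; one Hales-Jewett line in
    the [n1] letters then serves the finitely many pairs of a prefix and a word of later
    coordinates. *)
Lemma colour_blind_space (K L : finType) (T : eqType) (i : K -> L) (p : L -> T) :
  (forall u v, p u = p v -> u = v \/ exists a b, u = i a /\ v = i b) ->
  hales_jewett K -> forall M P, exists N, forall c : pred (seq L),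
  exists phi : template K, is_space M N phi /\
  forall pre x y, size pre = P -> size x = M -> map p x = map p y ->
    c (pre ++ phi L i x) = c (pre ++ phi L i y).
Proof.
move=> pP HJ; elim=> [|M IH] P.
  exists 0 => c; exists (const_template [::]); split; first exact: (is_space_const [::]).
  by [].
have [n1 n1P] := HJ (P.-tuple L * M.-tuple L)%type.
have [N NP] := IH (P + n1)%N.
exists (n1 + N)%N => c.
have [phi [sp phiP]] := NP c.
have [l [sl Nl lP]] := n1P (fun pr u => c (pr.1 ++ map i u ++ phi L i pr.2)).
exists (cat_template 1 (line_template l) phi); split.
  by have := is_space_line Nl; rewrite sl => /is_space_cat; apply.
move=> pre [|b x] [|b' y] //= spre [sx] [pb pxy].
have sy : size y = M by rewrite -sx -(size_map p x) pxy size_map.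
rewrite /cat_template /= !drop0 !catA (phiP _ x y) ?size_cat ?size_map ?spre ?sl // -!catA.
have [->//|[a [a' [-> ->]]]] := pP _ _ pb.
have spre' : size pre == P by apply/eqP.
have sy' : size y == M by apply/eqP.
have := lP (Tuple spre', Tuple sy') a a' => /=.
rewrite -!map_comp => lPa.
have E d : map (oapp i (i d)) l = map (i \o odflt d) l by apply: eq_map => -[].
by rewrite !E.
Qed.

(* The only constant of [phi] is [false], so its coordinates are disjoint sets of
   positions, and the image of [e] is the union of those selected by [e]. *)
Definition monochromatic_unions (c : pred (seq bool)) (s : bool) p N : Prop :=
  exists phi : template unit, is_space p N phi /\
  forall e, size e = p -> true \in e -> c (phi bool (fun=> false) e) = s.

(* The first letter [z] of the word also replaces the constants [true] of [psi],
   so that they are absorbed into the set of positions of the new coordinate. *)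
Definition attach_constants (phi : template unit) (psi : template bool) : template unit :=
  fun L i w => if w is z :: w' then
    psi L (fun b => if b then z else i tt) (phi L i w') ++ [:: z] else [::].

Lemma is_space_attach_constants p D N (phi : template unit) (psi : template bool) :
  is_space p D phi -> is_space D N psi ->
  is_space p.+1 (N + 1) (attach_constants phi psi).
Proof.
move=> sp sp'; split=> [L i [|z w] // [sw]|L L' i g [|z w] // [sw]|L i [|z w] // y [sw]] /=.
- by rewrite size_cat (space_size sp') ?(space_size sp).
- rewrite map_cat (space_map sp') ?(space_size sp) // (space_map sp) //.
  by congr (psi _ _ _ ++ _); apply: funext => -[].
- rewrite inE mem_cat inE => /orP[->|yw]; first by rewrite orbT.
  by rewrite (space_mem sp') ?(space_size sp) ?(space_mem sp).
Qed.

(** Unions ending in [true] have colour [s] throughout [psi], those ending in [false] are coloured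
    by [c']. A family of colour [s] for [c'] is therefore extended by a coordinate that holds the
    last position. *)
Lemma monochromatic_unions_step c s p q N D N' (psi : template bool) :
  (forall c', monochromatic_unions c' s p N \/ monochromatic_unions c' (~~ s) q N) ->
  (N <= D)%N -> is_space D N' psi ->
  (forall w, size w = D -> c (psi bool id w ++ [:: true]) = s) ->
  monochromatic_unions c s p.+1 (N' + 1) \/ monochromatic_unions c (~~ s) q (N' + 1).
Proof.
move=> H ND sp psiP.
pose pad := cat_template N (@id_template unit) (const_template (nseq (D - N) tt)).
have spad : is_space N D pad by apply: is_space_const_cat; rewrite ?size_nseq.
pose c' e := c (psi bool (fun=> false) (pad bool (fun=> false) e) ++ [:: false]).
have [[phi [sphi phiP]]|[phi [sphi phiP]]] := H c'; [left|right].
  exists (attach_constants (comp_template pad phi) psi); split.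
    by apply: is_space_attach_constants sp; exact: is_space_comp spad sphi.
  move=> [|z e] //= [se]; rewrite inE => ze.
  case: z ze => /= [_|ze].
    rewrite (_ : (fun b : bool => if b then true else false) = id); last by apply: funext => -[].
    by apply: psiP; rewrite (space_size spad) ?(space_size sphi).
  rewrite (_ : (fun b : bool => if b then false else false) = fun=> false); last first.
    by apply: funext => -[].
  exact: phiP.
exists (cat_template q (comp_template (lift_template (fun=> tt) psi) (comp_template pad phi))
  (const_template [:: tt])).
split.
  rewrite -[X in is_space X](addn0 q); apply: is_space_cat; last exact: is_space_const [:: tt].
  by apply: is_space_comp (is_space_comp spad sphi); exact: is_space_lift.
move=> e se te; rewrite -(phiP e se te) /cat_template take_oversize ?se //.
Qed.

(** The finite unions theorem for two colours, by double induction as for Ramsey numbers: the common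
    colour of the unions ending in [true] decides whether [p] or [q] drops. *)
Lemma finite_unions p q : exists N, forall c,
  monochromatic_unions c true p N \/ monochromatic_unions c false q N.
Proof.
have base (c : pred (seq bool)) s : monochromatic_unions c s 0 0.
  exists (const_template [::]); split; first exact: (is_space_const [::]).
  by move=> e /size0nil ->.
elim: p q => [|p IHp] q; first by exists 0 => c; left.
elim: q => [|q [N2 N2P]]; first by exists 0 => c; right.
have [N1 N1P] := IHp q.+1.
have [] := @colour_blind_space bool bool unit id (fun=> tt) _ hales_jewett_bool (maxn N1 N2) 0.
  by move=> u v _; right; exists u, v.
move=> N' N'P; exists (N' + 1)%N => c.
have [psi [sp psiP]] := N'P (fun w => c (w ++ [:: true])).
pose s := c (psi bool id (nseq (maxn N1 N2) true) ++ [:: true]).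
have cs w : size w = maxn N1 N2 -> c (psi bool id w ++ [:: true]) = s.
  move=> sw; apply: (psiP [::]) => //.
  by rewrite -sw map_nseq; elim: (w) => //= _ w' <-.
case Es : s cs => cs.
  by apply: monochromatic_unions_step sp cs => //; exact: leq_maxl.
suff : monochromatic_unions c false q.+1 (N' + 1) \/
    monochromatic_unions c (~~ false) p.+1 (N' + 1).
  by case; [right|left].
apply: monochromatic_unions_step sp cs; last exact: leq_maxr.
by move=> c'; case: (N2P c'); [right|left].
Qed.

(** On a colour-blind subspace the colour depends only on the set of positions of [None], and
    [finite_unions] applies to such sets; [a0] merely fills the other positions. *)
Lemma graham_rothschild (K : finType) (a0 : K) : hales_jewett K ->
  forall p q, exists N, forall c : pred (seq (option K)),
  (exists phi : template K, is_space p N phi /\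
     forall x, size x = p -> None \in x -> c (phi _ Some x)) \/
  (exists phi : template K, is_space q N phi /\
     forall x, size x = q -> None \in x -> ~~ c (phi _ Some x)).
Proof.
move=> HJ p q; have [M MP] := finite_unions p q.
have [|N NP] := @colour_blind_space K (option K) bool Some isSome _ HJ M 0.
  by move=> [u|] [v|] // _; [right; exists u, v|left].
exists N => c; have [psi [sp psiP]] := NP c.
pose h (b : bool) := if b then None else Some a0.
have key r s (phi : template unit) : is_space r M phi ->
    (forall e, size e = r -> true \in e ->
       c (psi _ Some (map h (phi bool (fun=> false) e))) = s) ->
    exists phi' : template K, is_space r N phi' /\
      forall x, size x = r -> None \in x -> c (phi' _ Some x) = s.
  move=> sphi H.
  exists (comp_template psi (lift_template (fun=> a0) phi)); split.
    by apply: is_space_comp sp _; exact: is_space_lift.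
  move=> x sx Nx; rewrite -(H (map (fun z => ~~ isSome z) x)) ?size_map //; last first.
    by apply/mapP; exists None.
  apply: (psiP [::]) => //; first by rewrite (space_size sphi).
  rewrite /lift_template !(space_map sphi) ?size_map // -!map_comp.
  by apply: congr1; apply: eq_map => -[].
case: (MP (fun e => c (psi _ Some (map h e)))) => -[phi [sphi phiP]]; [left|right].
  by have [phi' [s' P']] := key p true phi sphi phiP; exists phi'.
have [phi' [s' P']] := key q false phi sphi phiP; exists phi'; split=> // x sx Nx.
by rewrite P'.
Qed.

(** * The density Hales-Jewett theorem *)

Lemma forces_line_le (R : realType) (K : finType) (d d' : R) :
  d <= d' -> forces_line K d -> forces_line K d'.
Proof. by move=> dd' [n nP]; exists n => A /(le_trans dd') /nP. Qed.

Lemma forces_line_gt1 (R : realType) (K : finType) (d : R) :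
  (0 < #|K|)%N -> 1 < d -> forces_line K d.
Proof.
move=> K0 d1; exists 0 => A dA; have : (A [::])%:R <= 1 :> R by case: (A _).
by move: dA => /=; lra.
Qed.

Lemma has_line_space (K : finType) d n (phi : template K) (A : pred (seq K)) :
  is_space d n phi -> has_line d (fun w => A (phi _ id w)) -> has_line n A.
Proof.
move=> sp [l [sl Nl lA]]; exists (phi _ Some l); split=> [||a].
- exact: space_size sp _ _ _ sl.
- exact: space_mem sp _ _ _ _ sl Nl.
- by rewrite (space_map sp) //; exact: lA.
Qed.

Lemma avg_no_None (R : realType) (K : finType) n :
  avg n (fun x : seq (option K) => (None \notin x)%:R) =
  (#|K|%:R / #|{: option K}|%:R) ^+ n :> R.
Proof.
elim: n => [|n IH] /=; first by rewrite expr0.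
rewrite sum_option (eq_bigr (fun=> (#|K|%:R / #|{: option K}|%:R) ^+ n)) => [|a _].
  rewrite sumr_const (_ : avg n _ = 0) ?add0r; last first.
    by rewrite -[RHS](avg0 R (option K) n); apply: eq_avg => w _; rewrite inE.
  by rewrite exprS -[_ ^+ n *+ _]mulr_natl mulrCA mulrA.
by rewrite -IH; apply: eq_avg => w _; rewrite inE.
Qed.

(* [d] plays the role of the critical density, at which line-free sets in
   high dimension are almost equidistributed over the fibers of a projection. *)
Lemma critical_density_increment (R : realType) (K : finType) (d : R) :
  (0 < #|K|)%N -> density_hales_jewett R K -> 0 < d -> d <= 1 ->
  (forall e, 0 < e -> forces_line (option K) (d + e)) ->
  exists2 e, 0 < e & forces_line (option K) (d - e).
Proof.
move=> K0 DHJ d0 d1 dP.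
have [a0 _] := card_gt0P K0.
have O0 : (0 < #|{: option K}|)%N by rewrite card_option.
have d4 : 0 < d / 4 by lra.
have [n0 n0P] := DHJ _ d4.
pose I := n0.-tuple (option K).
have I0 : (0 < #|{: I}|)%N by rewrite card_tuple expn_gt0 O0.
pose t := d / 2 / 2 / #|{: I}|%:R.
have t0 : 0 < t by rewrite !divr_gt0 ?ltr0n.
have td : t <= d / 4.
  rewrite /t ler_pdivrMr ?ltr0n //; apply: (@le_trans _ _ (d / 4 * 1)); first lra.
  by rewrite ler_pM2l // ler1n.
have td0 : 0 < t * d by rewrite mulr_gt0.
(* Here [t * d] is the gain from discarding a set of density [t]. The losses are [g], the increment
   aimed at, and twice [e] below: once for fibers thinner than [d], once for words without [None].
   What remains is [t * d / 2]. *)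
pose g := t * d / 4.
have g0 : 0 < g by rewrite /g; lra.
have [dd ddP] := dP _ g0.
pose e := t * d / 8.
have e0 : 0 < e by rewrite /e; lra.
have rho0 : 0 < t * d / 2 by lra.
have [m1 [e1 [e10 m1P]]] := intersection_increment DHJ (enum K) dd rho0.
have q0 : 0 <= #|K|%:R / #|{: option K}|%:R :> R by rewrite divr_ge0.
have q1 : #|K|%:R / #|{: option K}|%:R < 1 :> R.
  by rewrite ltr_pdivrMr ?ltr0n // mul1r ltr_nat card_option.
have [m2 m2P] := exists_expr_le q0 q1 e0.
pose m := maxn m1 m2.
have {}m2P : (#|K|%:R / #|{: option K}|%:R) ^+ m <= e.
  by apply: le_trans m2P; apply: ler_wiXn2l; rewrite ?leq_maxr ?(ltW q1).
have [N NP] := graham_rothschild a0 (hales_jewett_of_density K0 DHJ) m n0.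
pose k := #|{: option K}|%:R ^- N : R.
have k0 : 0 < k by rewrite invr_gt0 exprn_gt0 ?ltr0n.
have ke0 : 0 < k * e / 2 by rewrite divr_gt0 // mulr_gt0.
have [M MP] := dP _ ke0.
exists (k * e / 2) => //; exists (N + M)%N => A dA; apply: contrapT => noline.
pose mu x := avg M (fun y => (A (x ++ y))%:R : R).
have mu_le x : size x = N -> mu x <= d + k * e / 2.
  move=> sx; rewrite leNgt; apply/negP => /ltW/MP lA; apply: noline.
  have sp := is_space_cat (is_space_const x) (is_space_id (option K) M).
  rewrite -sx; apply: has_line_space sp _; move: lA; congr has_line.
  by apply: funext => w; rewrite /cat_template drop0 /const_template map_id.
(* The average of [mu] is within [k * e] of its upper bound, and [k] is the mass of one word, so no
   value can be lower by more than [e]. *)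
have mu_ge x : size x = N -> d - e <= mu x.
  move=> sx; have := avg_point O0 mu_le sx; rewrite -/k => h.
  have h1 : d - k * e / 2 <= avg N mu by move: dA; rewrite avg_cat.
  have h2 : k * (d + k * e / 2 - mu x) <= k * e by lra.
  have h3 : 0 < k * e by rewrite mulr_gt0.
  by move: h2; rewrite ler_pM2l //; lra.
have e_d : e <= d / 2.
  have : t * d <= d / 4 * 1 by apply: ler_pM => //; exact: ltW.
  by rewrite /e; lra.
pose c x := t <= avg M (fun y => [forall a, A (map Some (map (odflt a) x) ++ y)]%:R : R).
(* Every [mu x] is at least [d / 2], so some line of each [n0]-dimensional
   subspace satisfies [c]: the second alternative of Graham-Rothschild fails. *)
case: (NP c) => -[phi [sp phiP]]; last first.
  have dg : d / 2 <= avg M (fun y => avg n0 (fun w => (A (map Some (phi _ id w) ++ y))%:R : R)).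
    rewrite exchange_avg; apply: avg_ge_cst => // w sw.
    apply: le_trans (mu_ge _ _); first lra.
    by rewrite size_map (space_size sp).
  have d2 : 0 < d / 2 by lra.
  have [|y sy|l] := fiber_pigeonhole (P := fun (l : I) y => None \in (l : seq _) /\
     forall a, A (map Some (phi _ id (map (odflt a) l)) ++ y)) O0 d2 _ _ dg.
  - by move=> y _; apply: avg_le_cst => // w _; case: (A _).
  - rewrite (_ : d / 2 / 2 = d / 4); last lra.
    move=> /(n0P (fun w => A (map Some (phi _ id w) ++ y))) [l [/eqP sl Nl lA]].
    by exists (Tuple sl).
  rewrite -/t => tl.
  have [y0 _ y0P] := avg_ex O0 tl.
  have Nl : None \in (l : seq _).
    have : 0 < (`[< None \in (l : seq _) /\
       forall a, A (map Some (phi _ id (map (odflt a) l)) ++ y0) >])%:R :> R.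
      exact: lt_le_trans y0P.
    by case: asboolP => [[]|]; rewrite ?ltxx.
  have := phiP l (size_tuple l) Nl; rewrite /c => /negP; apply.
  apply: le_trans tl _; apply: le_avg => y _; rewrite ler_nat.
  case: asboolP => // -[_ lA]; rewrite lt0b; apply/forallP => a.
  by rewrite (map_odflt_space a sp) // size_tuple.
pose B y x := A (phi _ Some x ++ y).
pose C y a x := B y (map (Some \o odflt a) x).
have Ci y a : insensitive a (C y a).
  by move=> x x' xx'; rewrite /C !(map_comp Some (odflt a)) xx'.
have muC x : size x = m -> t <= avg M (fun y => (all (C y ^~ x) (enum K))%:R).
  move=> sx; have [Nx|Nx] := boolP (None \in x).
    apply: le_trans (phiP x sx Nx) _; apply: le_avg => y _; rewrite ler_nat.
    case: forallP => // H; rewrite lt0b; apply/allP => a _; have := H a.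
    rewrite /C /B (map_odflt_space a sp) // (space_map sp) ?size_map //.
    by rewrite -map_comp.
  have Ex a : map (Some \o odflt a) x = x.
    rewrite -[RHS]map_id; apply/eq_in_map => -[//|xN].
    by rewrite xN in Nx.
  apply: (@le_trans _ _ (mu (phi _ Some x))).
    by apply: le_trans (mu_ge _ _); [lra|rewrite (space_size sp)].
  apply: le_avg => y _; rewrite ler_nat; case Ay : (A _) => //; rewrite lt0b.
  by apply/allP => a _; rewrite /C /B Ex.
(* A point [x] with a letter [None] in [B y] and in all the [C y a] would give a
   line over [option K] in [A]. *)
have BC y x : size y = M -> size x = m -> (B y x)%:R - (None \notin x)%:R <=
    (~~ all (C y ^~ x) (enum K))%:R * (B y x)%:R :> R.
  move=> sy sx; case Bx : (B y x); last by rewrite mulr0 sub0r oppr_le0 ler0n.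
  case: (boolP (None \in x)) => Nx /=; last by rewrite subrr mulr1.
  case: allP => [H|_]; last by rewrite subr0 mul1r.
  exfalso; apply: noline.
  pose h z := if z is Some b then Some (Some b) else None : option (option K).
  exists (phi _ (Some \o Some) (map h x) ++ map Some y); split.
  - by rewrite size_cat size_map (space_size sp) ?size_map // sy.
  - rewrite mem_cat (space_mem sp) ?size_map //; apply/mapP; exists None => //.
  - move=> b; rewrite map_cat (space_map sp) ?size_map // map_odflt_Some -map_comp.
    case: b => [b|].
      rewrite (_ : map _ x = map (Some \o odflt b) x); last by apply: eq_map => -[].
      by apply: H; rewrite mem_enum.
    by rewrite (_ : map _ x = x) // -[RHS]map_id; apply: eq_map => -[].
pose f y x := (B y x)%:R - (d + g).
(* By [BC], apart from words without [None], [B y] lies outside the intersection of the [C y a].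
   That outside has density at most [1 - t] on average over [y], so [B y] is denser than [d + g]
   there for some [y]. *)
have [y sy yP] : exists2 y, size y = M &
    t * d / 2 <= avg m (fun x => (~~ all (C y ^~ x) (enum K))%:R * f y x).
  apply: avg_ex => //.
  apply: (@le_trans _ _ (avg M (fun y => avg m (fun x => (B y x)%:R - (None \notin x)%:R
     - (d + g) * (1 - (all (C y ^~ x) (enum K))%:R))))); last first.
    apply: le_avg => y sy; apply: le_avg => x sx; rewrite /f.
    by have := BC y x sy sx; case: (all _ _) => /=; lra.
  rewrite exchange_avg.
  apply: (@le_trans _ _ (avg m (fun x : seq (option K) =>
      (d - e) - (None \notin x)%:R - (d + g) * (1 - t)))).
    rewrite avgB avgB avg_no_None !(avg_cst _ _ O0); rewrite /g /e in m2P *.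
    have : 0 <= t * d / 4 * t by rewrite mulr_ge0 // ltW //; lra.
    by lra.
  apply: le_avg => x sx; rewrite !avgB avgZ avgB !(avg_cst _ _ O0).
  have h1 : d - e <= avg M (fun y => (B y x)%:R) by apply: mu_ge; rewrite (space_size sp).
  have h2 := muC x sx.
  have h3 : 0 <= (d + g) * (avg M (fun y => (all (C y ^~ x) (enum K))%:R) - t).
    by rewrite mulr_ge0 ?subr_ge0 // addr_ge0 // ltW.
  by lra.
have f1 x : f y x <= 1 by rewrite /f; case: (B y x) => /=; lra.
(* On this [dd]-dimensional subspace [B y] has density above [d + g], and [dd] was chosen so that
   this forces a line. *)
have [psi [spsi psiP]] := m1P _ (leq_maxl m1 m2) (C y) (f y) (Ci y) f1 yP.
have : d + g <= avg dd (fun w => (B y (psi _ id w))%:R).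
  move: psiP; rewrite /f avgB (avg_cst _ _ O0); lra.
move=> /(ddP (fun w => B y (psi _ id w))) /(has_line_space spsi) lB; apply: noline.
have sp' : is_space m (N + M) (cat_template m (lift_template Some phi) (const_template y)).
  by rewrite -[X in is_space X](addn0 m) -sy; apply: is_space_cat;
    [exact: is_space_lift|exact: is_space_const].
apply: has_line_space sp' _; case: lB => l [sl Nl lB]; exists l; split=> // b.
by rewrite /cat_template take_oversize ?size_map ?sl // /const_template map_id; exact: lB.
Qed.

(** The infimum of the densities that force a line is the critical density; if it were positive, a
    smaller density would also force a line. *)
Lemma density_hales_jewett_option (R : realType) (K : finType) :
  (0 < #|K|)%N -> density_hales_jewett R K -> density_hales_jewett R (option K).
Proof.
move=> K0 DHJ d1 d10; apply: contrapT => nd1.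
pose S := [set d : R | forces_line (option K) d].
have S_ge : lbound S d1.
  by move=> d Sd; rewrite leNgt; apply/negP => /ltW/forces_line_le H; apply: nd1; exact: H.
have O0 : (0 < #|{: option K}|)%N by rewrite card_option.
have S0 : S !=set0 by exists 2; apply: forces_line_gt1 => //; lra.
have infS : has_inf S by split=> //; exists d1.
have inf_ge : d1 <= inf S by apply: lb_le_inf.
have inf_le : inf S <= 1.
  apply/ler_addgt0Pr => e e0; apply: ge_inf; first by case: infS.
  by apply: forces_line_gt1 => //; lra.
have infP e : 0 < e -> forces_line (option K) (inf S + e).
  by move=> /(inf_adherent) /(_ infS) [d Sd /ltW/forces_line_le]; apply.
have [e e0 eP] := critical_density_increment K0 DHJ (lt_le_trans d10 inf_ge) inf_le infP.
have : inf S <= inf S - e by apply: ge_inf => //; case: infS.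
lra.
Qed.

(** The [r + 1] letters stand for the terms of a progression; iterating [option] matches the
    induction step literally. *)
Fixpoint alphabet (r : nat) : finType := if r is r'.+1 then option (alphabet r') else unit.

Lemma card_alphabet r : #|{: alphabet r}| = r.+1.
Proof. by elim: r => [|r IH]; rewrite ?card_unit //= card_option IH. Qed.

Theorem density_hales_jewett_alphabet (R : realType) r : density_hales_jewett R (alphabet r).
Proof.
elim: r => [|r IH]; last by apply: density_hales_jewett_option => //; rewrite card_alphabet.
move=> d d0; exists 1 => A dA; exists [:: None]; split=> // -[] /=.
move: dA; rewrite /= card_unit invr1 mul1r.
rewrite (bigD1 tt) //= big_pred0 => [|[]//]; rewrite addr0.
by case: (A _) => //; rewrite leNgt d0.
Qed.

(** * Upper Banach density *)

Definition window (A : set nat) (k s : nat) : nat := count (fun i => `[< A i >]) (iota k.+1 s).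

Lemma card_window (A : set nat) k s : #|` fset_set (A `&` `[k.+1, (k + s)%N]) | = window A k s.
Proof.
rewrite /window -size_filter; apply: perm_size; apply: uniq_perm.
- exact: fset_uniq.
- by rewrite filter_uniq ?iota_uniq.
have fin : finite_set (A `&` `[k.+1, (k + s)%N]).
  apply: (sub_finite_set _ (finite_II (k + s).+1)) => i [_ /=].
  by rewrite in_itv /= ltnS => /andP[].
move=> i; rewrite in_fset_set //.
apply/idP/idP; rewrite mem_filter mem_iota addSn ltnS.
  by move=> /set_mem [Ai /=]; rewrite in_itv /= => ->; rewrite andbT; apply/asboolP.
move=> /andP[/asboolP Ai ki]; by apply/mem_set.
Qed.

Lemma window_le (A : set nat) k s : (window A k s <= s)%N.
Proof. by rewrite -[leqRHS](size_iota k.+1); exact: count_size. Qed.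

Lemma window_add (A : set nat) k s t : window A k (s + t) = (window A k s + window A (k + s) t)%N.
Proof. by rewrite /window iotaD count_cat addSn. Qed.

Lemma bounded_window (R : realType) (A : set nat) s :
  bounded_fun (fun k => (window A k s)%:R : R^o).
Proof.
exists s%:R; split; first exact: num_real.
move=> x sx k _; rewrite /= ger0_norm //; apply: le_trans (ltW sx).
by rewrite ler_nat window_le.
Qed.

Lemma max_windowE (R : realType) (A : set nat) s :
  max_window R A s = inf (range (sups (fun k => (window A k s)%:R : R))).
Proof.
rewrite -limn_supE; last exact: bounded_window.
by congr limn_sup; apply: funext => k; rewrite card_window.
Qed.

Lemma max_window_ge (R : realType) (A : set nat) s (x : R) :
  (forall k0, exists2 k, (k0 <= k)%N & x <= (window A k s)%:R) -> x <= max_window R A s.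
Proof.
move=> H; rewrite max_windowE; apply: lb_le_inf.
  by exists (sups (fun k => (window A k s)%:R) 0); exists 0.
move=> _ [k0 _ <-]; have [k k0k xk] := H k0; apply: le_trans xk _.
apply: ub_le_sup; last by exists k.
by exists s%:R => _ [j _ <-]; rewrite ler_nat window_le.
Qed.

Lemma max_window_gt (R : realType) (A : set nat) s (x : R) :
  x < max_window R A s -> forall k0, exists2 k, (k0 <= k)%N & x < (window A k s)%:R.
Proof.
rewrite max_windowE => xm k0.
have : x < sups (fun k => (window A k s)%:R) k0.
  apply: lt_le_trans xm _; apply: ge_inf; last by exists k0.
  exists 0 => _ [j _ <-]; apply: (@le_trans _ _ (window A j s)%:R) => //.
  apply: ub_le_sup; last by exists j => /=.
  by exists s%:R => _ [i _ <-]; rewrite ler_nat window_le.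
move=> /(sup_gt _)[|_ [k /= k0k <-] xk]; first by exists (window A k0 s)%:R; exists k0 => /=.
by exists k.
Qed.

Lemma max_window_add (R : realType) (A : set nat) s t :
  max_window R A (s + t) <= max_window R A s + max_window R A t.
Proof.
have near_le u (y : R) : max_window R A u < y -> exists k0, forall k, (k0 <= k)%N ->
    (window A k u)%:R < y.
  move=> uy; apply: contrapT => nex; move: uy; apply/negP; rewrite -leNgt.
  apply: max_window_ge => k0; apply: contrapT => nk; apply: nex; exists k0 => k k0k.
  by rewrite ltNge; apply/negP => ?; apply: nk; exists k.
have : forall x, x < max_window R A (s + t) -> forall k0,
    exists2 k, (k0 <= k)%N & x < (window A k (s + t))%:R.
  by move=> x; exact: max_window_gt.
have := near_le s; have := near_le t.
move: (max_window R A s) (max_window R A t) (max_window R A (s + t)).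
move=> a b c bP aP cP; rewrite leNgt; apply/negP => lt_st.
pose e := (c - (a + b)) / 3.
have e3 : e * 3 = c - (a + b) by rewrite /e divfK.
have e0 : 0 < e by rewrite divr_gt0 // subr_gt0.
have [k1 k1P] := aP (a + e) ltac:(lra); have [k2 k2P] := bP (b + e) ltac:(lra).
have [k] := cP (a + b + e + e) ltac:(lra) (maxn k1 k2).
rewrite geq_max => /andP[/k1P h1 k2k].
have h2 := k2P (k + s)%N (leq_trans k2k (leq_addr _ _)).
by rewrite window_add natrD; lra.
Qed.

Lemma fekete (R : realType) (u : nat -> R) :
  (forall m n, u (m + n)%N <= u m + u n) -> (forall n, 0 <= u n) ->
  (fun n => u n / n%:R) @ \oo --> inf (range (fun n => u n.+1 / n.+1%:R)).
Proof.
move=> ua u0; set L := inf _.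
have lbL : has_lbound (range (fun n => u n.+1 / n.+1%:R)).
  by exists 0 => _ [n _ <-]; rewrite divr_ge0.
apply/cvgrPdist_le => e e0.
have e2 : 0 < e / 2 by lra.
have infL : has_inf (range (fun n => u n.+1 / n.+1%:R)).
  by split => //; exists (u 1 / 1%:R); exists 0.
have [_ [m' _ <-]] := inf_adherent e2 infL; rewrite -/L; set m := m'.+1 => mL.
(* [C] bounds [u r] for all remainders [r < m] at once, the terms being nonnegative. *)
pose C := \sum_(r < m) u r.
have C0 : 0 <= C by apply: sumr_ge0.
have uq q r : u (q * m + r)%N <= q%:R * u m + u r.
  elim: q => [|q IH]; first by rewrite mul0r add0r.
  by rewrite mulSn -addnA -natr1 mulrDl mul1r; have := ua m (q * m + r)%N; lra.
exists (Num.truncn (2 * C / e)).+1 => // n /= nC.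
have n0 : 0 < n%:R :> R by rewrite ltr0n; apply: leq_trans nC.
have L_le : L <= u n / n%:R.
  apply: ge_inf => //; case: n n0 {nC} => [|n _]; first by rewrite ltxx.
  by exists n.
rewrite ler0_norm ?subr_le0 // opprB lerBlDr.
have h1 : u n <= (n %/ m)%:R * u m + C.
  rewrite [in u n](divn_eq n m); apply: le_trans (uq _ _) _; rewrite lerD2l.
  have rm : (n %% m < m)%N by rewrite ltn_mod.
  by rewrite /C (bigD1 (Ordinal rm)) //= lerDl sumr_ge0.
have h2 : (n %/ m)%:R * u m <= n%:R * (u m / m%:R).
  rewrite mulrCA mulrC ler_wpM2l //.
  by rewrite ler_pdivlMr ?ltr0n // -natrM ler_nat leq_trunc_div.
have h3 : C <= e / 2 * n%:R.
  have : 2 * C / e < n%:R.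
    apply: lt_le_trans (truncnS_gt _) _; by rewrite ler_nat.
  by rewrite ltr_pdivrMr //; lra.
rewrite ler_pdivrMr //.
have : n%:R * (u m / m%:R) <= n%:R * (L + e / 2) by rewrite ler_pM2l // ltW.
lra.
Qed.

(** By Fekete's lemma the limit is an infimum, so it bounds [max_window R A s / s%:R] from below for
    every positive [s]. Halving it leaves room for a strict inequality, attained by arbitrarily
    distant windows. *)
Lemma upper_banach_density_gt0P (R : realType) (A : set nat) :
  0 < upper_banach_density R A <->
  exists2 d : R, 0 < d & forall s k0, exists2 k, (k0 <= k)%N & d * s%:R <= (window A k s)%:R.
Proof.
have w0 s : 0 <= max_window R A s by apply: max_window_ge => k; exists k.
have fek := fekete (max_window_add R A) w0.
have lim_le s : upper_banach_density R A * s%:R <= max_window R A s.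
  rewrite /upper_banach_density (cvg_lim _ fek) //.
  case: s => [|s]; first by rewrite mulr0.
  rewrite -ler_pdivlMr ?ltr0n //; apply: ge_inf; last by exists s.
  by exists 0 => _ [n _ <-]; rewrite divr_ge0.
split=> [b0|[d d0 dP]].
  exists (upper_banach_density R A / 2) => [|[|s] k0]; first by rewrite divr_gt0.
    by exists k0 => //; rewrite mulr0.
  have : upper_banach_density R A / 2 * s.+1%:R < max_window R A s.+1.
    apply: lt_le_trans (lim_le s.+1); rewrite ltr_pM2r ?ltr0n //; lra.
  by move=> /max_window_gt /(_ k0) [k ? /ltW]; exists k.
apply: lt_le_trans d0 _; rewrite /upper_banach_density; apply: limr_ge.
  by apply/cvg_ex; eexists; exact: fek.
exists 1 => // s /= s0; rewrite ler_pdivlMr ?ltr0n //.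
by apply: max_window_ge => k0; exact: dP.
Qed.

Lemma upper_banach_density_gt0_sub (R : realType) (A B : set nat) :
  A `&` [set a | (1 <= a)%N] `<=` B -> 0 < upper_banach_density R A -> 0 < upper_banach_density R B.
Proof.
move=> AB /upper_banach_density_gt0P [d d0 dP]; apply/upper_banach_density_gt0P.
exists d => // s k0; have [k k0k kP] := dP s k0; exists k => //.
apply: le_trans kP _; rewrite ler_nat /window.
have -> : count (fun i => `[< A i >]) (iota k.+1 s) =
    count (fun i => `[< A i >] && (0 < i)%N) (iota k.+1 s).
  apply: eq_in_count => i; rewrite mem_iota => /andP[ki _].
  by rewrite (leq_ltn_trans _ ki) // andbT.
by apply: sub_count => i /andP[/asboolP Ai i0]; apply/asboolP/AB.
Qed.

(** Otherwise distant windows of some length [s] for [A], and [t] for [B], are all less than [d / 2]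
    full. They tile each distant window of length [t * s], where the union then has fewer than
    [d * (t * s)] points. *)
Lemma upper_banach_density_gt0U (R : realType) (A B : set nat) :
  0 < upper_banach_density R (A `|` B) ->
  0 < upper_banach_density R A \/ 0 < upper_banach_density R B.
Proof.
move=> /upper_banach_density_gt0P [d d0 dP].
have neg C : ~ 0 < upper_banach_density R C -> exists s k0, forall k, (k0 <= k)%N ->
    (window C k s)%:R < d / 2 * s%:R.
  move=> nC; apply: contrapT => nex; apply: nC; apply/upper_banach_density_gt0P.
  exists (d / 2) => [|s k0]; first by rewrite divr_gt0.
  apply: contrapT => nk; apply: nex; exists s, k0 => k k0k.
  by rewrite ltNge; apply/negP => ?; apply: nk; exists k.
apply: contrapT => /not_orP [/neg [s [k1 sP]] /neg [t [k2 tP]]].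
have blocks C u q k k0 : (forall k, (k0 <= k)%N -> (window C k u)%:R < d / 2 * u%:R) ->
    (k0 <= k)%N -> (window C k (q * u))%:R <= d / 2 * (q * u)%:R.
  move=> uP; elim: q k => [|q IH] k k0k; first by rewrite mul0n mulr0 /window.
  have := uP k k0k; have := IH (k + u)%N (leq_trans k0k (leq_addr _ _)).
  by rewrite mulSn window_add !natrD; lra.
have s0 : (0 < s)%N.
  rewrite lt0n; apply/eqP => s0; have := sP k1 (leqnn _).
  by rewrite s0 mulr0 /window ltxx.
have [k] := dP (t * s)%N (maxn k1 k2).
rewrite geq_max => /andP[k1k k2k]; rewrite leNgt => /negP; apply.
have strict q : (0 < q)%N -> (window A k (q * s))%:R < d / 2 * (q * s)%:R.
  case: q => // q _; have := sP k k1k.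
  have := blocks A s q (k + s)%N k1 sP (leq_trans k1k (leq_addr _ _)).
  by rewrite mulSn window_add !natrD; lra.
have t0 : (0 < t)%N.
  rewrite lt0n; apply/eqP => t0; have := tP k2 (leqnn _).
  by rewrite t0 mulr0 /window ltxx.
have h1 := strict t t0; have h2 := blocks B t s k k2 tP k2k.
have h3 : (window (A `|` B) k (t * s) <= window A k (t * s) + window B k (t * s))%N.
  rewrite /window -count_predUI -[leqLHS]addn0 leq_add // sub_count // => i.
  by move=> /asboolP[] ? /=; apply/orP; [left|right]; apply/asboolP.
move: h3; rewrite -(ler_nat R) natrD; rewrite mulnC in h2; lra.
Qed.

Lemma upper_banach_density_gt0_shift (R : realType) (A : set nat) n :
  0 < upper_banach_density R [set m | A (n + m)%N] -> 0 < upper_banach_density R A.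
Proof.
move=> /upper_banach_density_gt0P [d d0 dP]; apply/upper_banach_density_gt0P.
exists d => // s k0; have [k k0k kP] := dP s k0; exists (n + k)%N.
  exact: leq_trans (leq_addl _ _).
apply: le_trans kP _; rewrite ler_nat /window -addnS iotaDl count_map.
by rewrite sub_count // => i /asboolP ?; apply/asboolP.
Qed.

Lemma upper_banach_density_setT_gt0 (R : realType) :
  0 < upper_banach_density R [set n | (0 < n)%N].
Proof.
apply/upper_banach_density_gt0P; exists 1 => // s k0; exists k0 => //.
rewrite mul1r ler_nat /window; rewrite (eq_in_count (a2 := predT)).
  by rewrite count_predT size_iota.
by move=> i; rewrite mem_iota => /andP[ki _]; apply/asboolP; exact: leq_ltn_trans ki.
Qed.

(** * Essential idempotents *)

Lemma posnat_addA (a b c : posnat) :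
  posnat_add (posnat_add a b) c = posnat_add a (posnat_add b c).
Proof. by apply: val_inj; rewrite /= addnA. Qed.

Lemma ultra_addA (p q r : set_system posnat) :
  ultra_add (ultra_add p q) r = ultra_add p (ultra_add q r).
Proof.
apply: funext => A; congr (p _); apply: funext => n; congr (q _).
by apply: funext => m; congr (r _); apply: funext => k; rewrite /= posnat_addA.
Qed.

Lemma proper_ultra_add (p q : set_system posnat) :
  ProperFilter p -> ProperFilter q -> ProperFilter (ultra_add p q).
Proof.
move=> pp pq; split.
  by move=> /(@filter_ex _ p) [n /(@filter_ex _ q) [m]].
split.
- by apply: (@filterS _ p) (@filterT _ p _) => n _; exact: filterT.
- move=> A B; rewrite /ultra_add /= => pA pB; apply: filterS2 pA pB => n qA qB.
  by apply: filterS2 qA qB.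
- move=> A B AB; rewrite /ultra_add /= => pA; apply: filterS pA => n /= qA.
  by apply: filterS qA => m; exact: AB.
Qed.

Lemma ultra_ext (T : Type) (p q : set_system T) :
  UltraFilter p -> ProperFilter q -> p `<=` q -> p = q.
Proof. by move=> up pq /(max_filter pq). Qed.

Lemma filter_setC_False (T : Type) (F : set_system T) (A : set T) :
  ProperFilter F -> F A -> F (~` A) -> False.
Proof.
by move=> FF FA FCA; apply: (@filter_not_empty _ F); rewrite -(setICr A); exact: filterI.
Qed.

Lemma ultra_setC (T : Type) (p : set_system T) : ProperFilter p ->
  (forall A, p A \/ p (~` A)) -> UltraFilter p.
Proof.
move=> pp pC; split=> // G pG pG'; apply/seteqP; split=> // A GA.
have [//|/pG' GCA] := pC A.
by have := filter_setC_False pG GA GCA.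
Qed.

Lemma ultra_notin (T : Type) (p : set_system T) (A : set T) :
  UltraFilter p -> ~ p A -> p (~` A).
Proof. by move=> up npA; have [] := in_ultra_setVsetC A up. Qed.

Lemma ultra_ultra_add (p q : set_system posnat) :
  UltraFilter p -> UltraFilter q -> UltraFilter (ultra_add p q).
Proof.
move=> up uq; apply: ultra_setC => [|A]; first exact: proper_ultra_add.
have [|npA] := pselect (ultra_add p q A); [by left|right].
apply: (@filterS _ p) (ultra_notin up npA) => n /=; exact: ultra_notin.
Qed.

Lemma ultra_separation (T : Type) (F : set_system T) (B : set T) :
  ProperFilter F -> ~ F B -> exists p, [/\ UltraFilter p, F `<=` p & ~ p B].
Proof.
(* [G] is the filter generated by [F] and the complement of [B]. *)
move=> FF nFB; pose G := [set A | F (A `|` B)].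
have GF : ProperFilter G.
  split; first by rewrite /G /= set0U.
  split; first by rewrite /G /= setTU; exact: filterT.
  - by move=> A C FA FC; rewrite /G /= setUIl; exact: filterI.
  - by move=> A C AC; rewrite /G /= => FA; apply: filterS FA; exact: setSU.
have [p [up Gp]] := ultraFilterLemma GF; exists p; split=> //.
  by move=> A FA; apply: Gp; apply: filterS FA; exact: subsetUl.
move=> pB; have pCB : p (~` B) by apply: Gp; rewrite /G /= setUC setUv; exact: filterT.
exact: filter_setC_False pB pCB.
Qed.

(* A filter [F] stands for the closed set of ultrafilters containing it; this
   closed set is a semigroup. *)
Definition semigroup_filter (F : set_system posnat) : Prop :=
  ProperFilter F /\ forall p q, UltraFilter p -> UltraFilter q ->
    F `<=` p -> F `<=` q -> F `<=` ultra_add p q.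

Lemma maximal_semigroup_filter (F : set_system posnat) : semigroup_filter F ->
  exists G, [/\ semigroup_filter G, F `<=` G &
    forall H, semigroup_filter H -> G `<=` H -> H `<=` G].
Proof.
move=> sF; have FF := sF.1.
pose P (X : set_system posnat) := X = set0 \/ semigroup_filter X /\ F `<=` X.
have [C CP Ctot|G [PG Gmax]] := @Zorn_bigcup _ P.
  have [[X CX X0]|nC] := pselect (exists2 X, C X & X !=set0); last first.
    left; apply/seteqP; split=> // A [X CX XA]; exfalso; apply: nC.
    by exists X => //; exists A.
  have CS Y A : C Y -> Y A -> semigroup_filter Y /\ F `<=` Y.
    by move=> CY YA; have [Y0|//] := CP _ CY; rewrite Y0 in YA.
  have [A0 XA0] := X0; have [[FX sX] FsubX] := CS _ _ CX XA0.
  right; split; last by move=> A /FsubX XA; exists X.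
  split; last first.
    move=> p q up uq Up Uq A [Y CY YA]; have [[FY sY] _] := CS _ _ CY YA.
    apply: sY YA => // B YB; [apply: Up|apply: Uq]; by exists Y.
  split; first by move=> [Y CY Y0]; have [[FY _] _] := CS _ _ CY Y0; exact: filter_not_empty Y0.
  split; first by exists X => //; exact: filterT.
    move=> A B [Y CY YA] [Z CZ ZB].
    have [[FY _] _] := CS _ _ CY YA; have [[FZ _] _] := CS _ _ CZ ZB.
    have [YZ|ZY] := Ctot _ _ CY CZ.
      by exists Z => //; apply: filterI => //; exact: YZ.
    by exists Y => //; apply: filterI => //; exact: ZY.
  move=> A B AB [Y CY YA]; have [[FY _] _] := CS _ _ CY YA.
  by exists Y => //; exact: filterS YA.
case: PG => [G0|[sG FG]].
  exfalso; apply: (Gmax F); last by right; split.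
  rewrite G0; split; first exact: sub0set.
  by move=> /(_ setT filterT).
exists G; split=> // H sH GH; apply: contrapT => nHG.
apply: (Gmax H); first by split.
by right; split=> //; exact: subset_trans GH.
Qed.

Definition translates (q : set_system posnat) (A : set posnat) : set posnat :=
  [set n | q [set m | A (posnat_add n m)]].

(** For ultrafilters [s] and [q], this stands for the closed set of [p] containing [F] with
    [ultra_add p q = s]. *)
Definition solution_filter (F s q : set_system posnat) : set_system posnat :=
  [set D | exists C A, [/\ F C, s A & C `&` translates q A `<=` D]].

Lemma proper_solution_filter (F s q : set_system posnat) :
  ProperFilter F -> ProperFilter s -> ProperFilter q ->
  (forall C A, F C -> s A -> C `&` translates q A !=set0) ->
  ProperFilter (solution_filter F s q).
Proof.
move=> FF Fs Fq ne; split.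
  by move=> [C [A [FC sA sub0]]]; have [x Cx] := ne C A FC sA; exact: sub0 Cx.
split.
- by exists setT, setT; split=> //; exact: filterT.
- move=> D D' [C [A [FC sA CD]]] [C' [A' [FC' sA' CD']]].
  exists (C `&` C'), (A `&` A'); split; [exact: filterI|exact: filterI|].
  move=> n [[Cn C'n] qn]; split; [apply: CD|apply: CD']; split=> //.
    by apply: filterS qn => m [].
  by apply: filterS qn => m [].
- move=> D D' DD' [C [A [FC sA CD]]]; exists C, A; split=> //.
  exact: subset_trans DD'.
Qed.

Lemma sub_solution_filter (F s q : set_system posnat) : ProperFilter s ->
  F `<=` solution_filter F s q.
Proof. by move=> Fs C FC; exists C, setT; split=> //; exact: filterT. Qed.

Lemma solution_filter_translates (F s q : set_system posnat) A : ProperFilter F ->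
  s A -> solution_filter F s q (translates q A).
Proof. by move=> FF sA; exists setT, A; split=> //; exact: filterT. Qed.

(** The map [p |-> ultra_add p q] is continuous, so it sends the compact set given by [G] onto a
    closed set, the one given by [ultra_add G q]. *)
Lemma ultra_add_factor (G q s : set_system posnat) :
  ProperFilter G -> UltraFilter q -> UltraFilter s -> ultra_add G q `<=` s ->
  exists p, [/\ UltraFilter p, G `<=` p & s = ultra_add p q].
Proof.
move=> GF uq us Gs.
have PF : ProperFilter (solution_filter G s q).
  apply: proper_solution_filter => // C A GC sA; apply: contrapT => nex.
  have /Gs sCA : ultra_add G q (~` A).
    apply: (@filterS _ G) GC => n Cn; apply: (@ultra_notin _ q) => qA.
    by apply: nex; exists n.
  exact: filter_setC_False sA sCA.
have [p [up Pp]] := ultraFilterLemma PF; exists p; split=> //.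
  by apply: subset_trans Pp; exact: sub_solution_filter.
apply: ultra_ext; first exact: proper_ultra_add.
by move=> A sA; apply: Pp; exact: solution_filter_translates.
Qed.

(** Let [S] be the minimal closed semigroup given by [G], and [q] in [S]. Minimality gives
    [S + q = S], so [p + q = q] has solutions in [S]. They form the closed semigroup given by [H],
    hence all of [S], and [q] is one of them. *)
Theorem ellis_idempotent (F : set_system posnat) : semigroup_filter F ->
  exists p, [/\ UltraFilter p, F `<=` p & ultra_add p p = p].
Proof.
move=> /maximal_semigroup_filter [G [[GF sG] FG Gmax]].
have [q [uq Gq]] := ultraFilterLemma GF.
have GG1 : G `<=` ultra_add G q.
  move=> A GA; apply: contrapT => nGA.
  have [p [up Gp]] := ultra_separation GF nGA; apply.
  exact: (sG p q up uq Gp Gq A GA).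
have sG1 : semigroup_filter (ultra_add G q).
  split; first exact: proper_ultra_add.
  move=> s s' us us' Gs Gs'.
  have [p [up Gp ->]] := ultra_add_factor GF uq us Gs.
  have [p' [up' Gp' ->]] := ultra_add_factor GF uq us' Gs'.
  rewrite -ultra_addA (ultra_addA p) => A GA.
  have := sG p (ultra_add q p') up (ultra_ultra_add uq up') Gp (sG q p' uq up' Gq Gp').
  by apply; exact: GA.
have G1G := Gmax _ sG1 GG1.
have [p [up Gp qE]] : exists p, [/\ UltraFilter p, G `<=` p & q = ultra_add p q].
  by apply: ultra_add_factor => //; apply: subset_trans Gq.
pose H := solution_filter G q q.
have HF : ProperFilter H.
  apply: proper_solution_filter => // C A GC qA.
  apply: (@filter_ex _ p); apply: filterI; first exact: Gp.
  by move: qA; rewrite {1}qE.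
have sH : semigroup_filter H.
  split=> // p1 p2 up1 up2 Hp1 Hp2.
  have fixq r : UltraFilter r -> H `<=` r -> ultra_add r q = q.
    move=> ur Hr; apply/esym/ultra_ext; first exact: proper_ultra_add.
    by move=> A qA; apply: Hr; exact: solution_filter_translates.
  have u12 := ultra_ultra_add up1 up2.
  have GH : G `<=` H by exact: sub_solution_filter.
  move=> D [C [A [GC qA CD]]]; apply: filterS CD _; apply: filterI.
    apply: sG GC => //; exact: subset_trans GH _.
  have : ultra_add (ultra_add p1 p2) q A by rewrite ultra_addA !fixq.
  by [].
have HG : H `<=` G by apply: Gmax => //; exact: sub_solution_filter.
exists q; split=> //; first exact: subset_trans Gq.
apply/esym/ultra_ext; first exact: proper_ultra_add.
by move=> A qA; apply/Gq/HG; exact: solution_filter_translates.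
Qed.

Lemma exists_essential_idempotent (R : realType) :
  exists p, essential_idempotent R p.
Proof.
pose F := [set A | ~ 0 < upper_banach_density R (val @` (~` A : set posnat))].
have monoBD (A B : set nat) : A `<=` B -> 0 < upper_banach_density R A ->
    0 < upper_banach_density R B.
  by move=> AB; apply: upper_banach_density_gt0_sub => n [An _]; exact: AB.
have FF : ProperFilter F.
  split.
    apply; apply: monoBD (upper_banach_density_setT_gt0 R) => n /= n0.
    by exists (exist _ n n0) => //; rewrite setC0.
  split.
  - rewrite /F /= setCT image_set0 => /upper_banach_density_gt0P [d d0 dP].
    have [k _] := dP 1 0; rewrite mulr1 leNgt => /negP; apply.
    by rewrite /window /= asboolF // ?addn0.
  - move=> A B FA FB; rewrite /F /= setCI image_setU.
    by move=> /upper_banach_density_gt0U [/FA|/FB].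
  - move=> A B AB FA; rewrite /F /= => BB; apply: FA; apply: monoBD BB.
    by apply: image_subset; exact: subsetC.
(* The complement of each translate of [A] is a translate of a null set, hence null, so [q] contains
   all translates of [A]. *)
have sF : semigroup_filter F.
  split=> // p q up uq Fp Fq A FA.
  apply: (@filterS _ p _ setT) (@filterT _ p _) => n _; apply: Fq => /= BA; apply: FA.
  apply: (@upper_banach_density_gt0_shift R _ (val n)); apply: monoBD BA.
  by move=> _ [m nA <-]; exists (posnat_add n m).
have [p [up Fp pp]] := ellis_idempotent sF; exists p; split=> // A pA.
apply: contrapT => nA; have pCA : p (~` A) by apply: Fp; rewrite /F /= setCK.
exact: filter_setC_False pA pCA.
Qed.

(** * Recurrence *)

Fixpoint letter (r : nat) : alphabet r -> nat :=
  match r return alphabet r -> nat with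
  | 0 => fun=> 0%N
  | r'.+1 => fun a : option (alphabet r') => if a is Some b then letter b else r'.+1
  end.

Lemma letter_le r (a : alphabet r) : (letter a <= r)%N.
Proof. by elim: r a => [|r IH] // [a|] //=; exact: leqW. Qed.

Lemma letter_surj r j : (j <= r)%N -> exists a : alphabet r, letter a = j.
Proof.
elim: r => [|r IH]; first by rewrite leqn0 => /eqP ->; exists tt.
rewrite leq_eqVlt => /predU1P[->|]; first by exists None.
by move=> /IH [a <-]; exists (Some a).
Qed.

Fixpoint dot (cs xs : seq nat) : nat :=
  match cs, xs with c :: cs', x :: xs' => (c * x + dot cs' xs')%N | _, _ => 0%N end.

Lemma dot_le r (cs xs : seq nat) : all (fun c => (c <= r)%N) cs -> (dot cs xs <= r * sumn xs)%N.
Proof.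
elim: cs xs => [|c cs IH] [|x xs] //= /andP[cr /IH h].
by rewrite mulnDr leq_add // leq_mul.
Qed.

(** Along a line the sums form an arithmetic progression, whose difference is the sum of the entries
    of [xs] at the variable positions. *)
Lemma dot_line r (a : alphabet r) (l : seq (option (alphabet r))) xs :
  dot (map (@letter r) (map (odflt a) l)) xs =
  (dot (map (oapp (@letter r) 0%N) l) xs +
   letter a * dot (map (fun z => nat_of_bool (z == None)) l) xs)%N.
Proof.
elim: l xs => [|z l IH] [|x xs] /=; rewrite ?muln0 // IH.
by case: z => [b|] /=; lia.
Qed.

(* Density Hales-Jewett is applied to the words [w] with [a + dot w xs] in [A],
   for some [a] in a window where this set of words is dense. *)
Lemma ip_szemeredi (R : realType) (A : set nat) r : 0 < upper_banach_density R A ->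
  exists n, forall xs, size xs = n -> exists m : seq bool,
  [/\ size m = n, true \in m &
      exists a, forall j, (j <= r)%N -> A (a + j * dot (map nat_of_bool m) xs)%N].
Proof.
move=> /upper_banach_density_gt0P [d d0 dP].
have d2 : 0 < d / 2 by lra.
have [n nP] := @density_hales_jewett_alphabet R r _ d2.
exists n => xs sxs.
have K0 : (0 < #|{: alphabet r}|)%N by rewrite card_alphabet.
pose X := (r * sumn xs)%N.
have [k Xk kP] := dP X.+1 X.
(* For every [w], [J] contains the window shifted back by [D w]; the subtraction is exact since
   [X <= k]. Its [2 * X + 1] elements are fewer than twice the window length, which costs half of
   the density. *)
pose J := iota (k.+1 - X) (X + X.+1).
pose D (w : seq (alphabet r)) := dot (map (@letter r) w) xs.
have DX w : (D w <= X)%N.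
  by apply: dot_le; apply/allP => _ /mapP[a _ ->]; exact: letter_le.
have cnt w : (window A k X.+1 <= count (fun a => `[< A (a + D w)%N >]) J)%N.
  rewrite /J (_ : (X + X.+1 = (X - D w) + (X.+1 + D w))%N); last by have := DX w; lia.
  rewrite iotaD count_cat iotaD count_cat.
  apply: leq_trans (leq_addl _ _); apply: leq_trans (leq_addr _ _).
  have E : k.+1 = (D w + (k.+1 - X + (X - D w)))%N by have := DX w; lia.
  rewrite /window [X in (count _ (iota X _) <= _)%N]E iotaDl count_map.
  by apply: sub_count => i /=; rewrite addnC.
have [a _ aP] : exists2 a, a \in J & d / 2 <= avg n (fun w => `[< A (a + D w)%N >]%:R : R).
  apply: contrapT => nex.
  have lt_a a : a \in J -> avg n (fun w => `[< A (a + D w)%N >]%:R : R) <= d / 2.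
    by move=> aJ; rewrite leNgt; apply/negP => /ltW ?; apply: nex; exists a.
  have : d * X.+1%:R <= \sum_(a <- J) avg n (fun w => `[< A (a + D w)%N >]%:R : R).
    rewrite -avg_sum; apply: avg_ge_cst => // w _; apply: le_trans kP _.
    apply: (@le_trans _ _ (count (fun a => `[< A (a + D w)%N >]) J)%:R).
      by rewrite ler_nat.
    by rewrite -sum1_count natr_sum big_mkcond /=; apply: ler_sum => a _; case: asboolP.
  have : \sum_(a <- J) avg n (fun w => `[< A (a + D w)%N >]%:R : R) <= \sum_(a <- J) d / 2.
    by rewrite big_seq [leRHS]big_seq; apply: ler_sum.
  rewrite big_const_seq count_predT iter_addr_0 size_iota -[_ *+ _]mulr_natr natrD -!(natr1 X).
  move: (\sum_(a <- J) _) => S; rewrite !mulrDr !mulr1; lra.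
have [l [sl Nl lP]] := nP (fun w => `[< A (a + D w)%N >]) aP.
exists (map (fun z => z == None) l); split; first by rewrite size_map.
  by apply/mapP; exists None.
exists (a + dot (map (oapp (@letter r) 0%N) l) xs)%N => j /letter_surj [b <-].
have /asboolP := lP b; rewrite /D dot_line addnA.
by rewrite -map_comp.
Qed.

(** Idempotence gives [k] in [Q] with [-k + Q] again in [p]; the other summands are then sought in
    the intersection of [Q] with this translate. *)
Lemma idempotent_sums (p : set_system posnat) : UltraFilter p -> ultra_add p p = p ->
  forall n Q, p Q -> exists xs : seq nat, size xs = n /\
  forall m, size m = n -> true \in m ->
    exists2 k : posnat, Q k & val k = dot (map nat_of_bool m) xs.
Proof.
move=> up pp; elim=> [|n IH] Q pQ; first by exists [::]; split=> // m /size0nil ->.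
have pQ' : p [set k | p [set m | Q (posnat_add k m)]] by move: pQ; rewrite -{1}pp.
have [k [Qk Qk']] := @filter_ex _ p _ _ (filterI pQ pQ').
have [xs [sxs xsP]] := IH _ (filterI pQ Qk').
exists (val k :: xs); split=> [|[|b m] //= [sm]]; first by rewrite /= sxs.
rewrite inE; have [tm _|tm] := boolP (true \in m).
  have [k' [Qk1 Qk2] k'E] := xsP m sm tm.
  case: b; last by exists k'; rewrite // k'E mul0n add0n.
  by exists (posnat_add k k'); rewrite //= k'E mul1n.
rewrite orbF => /eqP <-; exists k => //.
suff -> : dot (map nat_of_bool m) xs = 0%N by rewrite mul1n addn0.
elim: m xs tm {sm sxs xsP} => [|c m IHm] [|x xs] //=.
by rewrite inE negb_or => /andP[cF /IHm ->]; case: c cF.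
Qed.

(** * Orbits and open sets *)

Lemma continuous_iter (T : topologicalType) (f : T -> T) n :
  continuous f -> continuous (iter n f).
Proof.
by move=> cf; elim: n => [|n IH] x; [exact: cvg_id|apply: continuous_comp; [exact: IH|exact: cf]].
Qed.

Lemma open_recurrence (T : topologicalType) (f : T -> T) (U : set T) (k r : nat) :
  continuous f -> open U -> open (\bigcap_(i in `[1%N, r]) (iter (i * k) f @^-1` U)).
Proof.
move=> cf oU; elim: r => [|r IH].
  by rewrite set_itv_ge ?bigcap_set0 //; exact: openT.
rewrite (_ : \bigcap_(i in _) _ = \bigcap_(i in `[1%N, r]) (iter (i * k) f @^-1` U) `&`
    (iter (r.+1 * k) f @^-1` U)).
  by apply: openI => //; apply: open_comp => // x _; exact: continuous_iter.
apply/seteqP; split=> y.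
  move=> H; split=> [i|]; last by apply: H; rewrite /= in_itv /= leEnat.
  rewrite /= in_itv /= leEnat => /andP[i1 ir]; apply: H.
  by rewrite /= in_itv /= leEnat i1 leqW.
case=> H Hr i; rewrite /= in_itv /= leEnat => /andP[i1].
rewrite leq_eqVlt => /predU1P[->//|ir].
by apply: H; rewrite /= in_itv /= leEnat i1.
Qed.

Theorem theorem9 (R : realType) (X : completeNormedModType R[i])
    (hsep : separable_space X) (hinf : infinite_dimensional X)
    (T : {linear X -> X}) (hT : continuous T) :
  reiteratively_hypercyclic T <->
  exists x : X, forall U : set X, open U -> U !=set0 ->
    forall r : nat, (1 <= r)%N ->
      Dstar R [set k : posnat |
        0 < upper_banach_density R
              [set a : nat | (1 <= a)%N /\
                 ((\bigcap_(i in `[1%N, r]) (iter (i * val k) T @^-1` U))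
                    `&` U) (iter a T x)]].
Proof.
split=> [[x xP]|[x xP]]; exists x => U oU U0; last first.
  (* Converse: an essential idempotent contains the set of [k] for [r = 1], so some [k] exists, and
     its visits to the intersection are visits to [U]. *)
  have [p ep] := exists_essential_idempotent R; have [up _ _] := ep.
  have [k] := @filter_ex _ p _ _ (xP U oU U0 1 isT p ep).
  by apply: upper_banach_density_gt0_sub => a [[_ [_ Ua]] _].
move=> r r1 p [up pp _]; apply: contrapT => /(ultra_notin up) pQ.
have [n nP] := ip_szemeredi r (xP U oU U0).
have [xs [sxs xsP]] := idempotent_sums up pp n pQ.
have [m [sm tm [a aP]]] := nP xs sxs.
have [k nQk kE] := xsP m sm tm; apply: nQk => /=.
pose V := (\bigcap_(i in `[1%N, r]) (iter (i * val k) T @^-1` U)) `&` U.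
have oV : open V.
  by apply: openI => //; exact: open_recurrence.
have V0 : V !=set0.
  exists (iter a T x); split; last by have := aP 0%N isT; rewrite mul0n addn0.
  move=> i /=; rewrite in_itv /= => /andP[_ ir].
  by rewrite /= -iterD addnC kE; exact: aP.
by apply: upper_banach_density_gt0_sub (xP V oV V0) => b [Vb b1].
Qed.
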